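(* Let $G$ and $H$ be locally compact, second countable groups, let $(X,\mu)$ be a standard Borel probability space, and let $\rho\colon G\times X\to X$ be a Borel action such that $\mu$ is quasi-invariant. Let $\psi\colon X'\to\Omega$ be the corresponding ergodic decomposition, with $(\Omega,\nu)$, $X'$, $\psi$, $\xi$ as in the context, and for each $\omega\in\Omega$ let $\rho_\omega$ be the restriction of $\rho$ to $G\times\psi^{-1}(\omega)$. Let $(Y,d)$ be a complete, separable metric space, let $\tau\colon H\times Y\to Y$ be a continuous action of $H$ on $Y$, and let $\pi\colon G\to H$ be a continuous homomorphism. There exists an essentially $(\rho,\tau,\pi)$-equivariant Borel map $\phi\colon X\to Y$ if and only if, for a.e. $\omega\in\Omega$, there exists an essentially $(\rho_\omega,\tau,\pi)$-equivariant Borel map $\phi_\omega\colon\psi^{-1}(\omega)\to Y$.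
   Context: Ergodic decomposition. For $G$, $(X,\mu)$, $\rho$ as in the claim there exist a standard Borel probability space $(\Omega,\nu)$, a conull $G$-invariant Borel subset $X'\subset X$, a $G$-invariant Borel map $\psi\colon X'\to\Omega$, and a Borel map $\xi\colon\Omega\to\mathrm{Prob}(X')$ (the standard Borel space of probability measures on $X'$) such that: $\xi(\omega)(\psi^{-1}(\omega))=1$ for each $\omega\in\Omega$; $\mu=\int_\Omega\xi(\omega)\,d\nu(\omega)$; and for each $\omega\in\Omega$ the measure $\xi(\omega)$ is quasi-invariant and ergodic. Such data are fixed. ''A.e. $\omega$'' refers to $\nu$; the space $\psi^{-1}(\omega)$ carries the measure $\xi(\omega)$. A Borel map $\phi\colon X\to Y$ is essentially $(\rho,\tau,\pi)$-equivariant if, for each $g\in G$, $\phi(\rho(g,x))=\tau(\pi(g),\phi(x))$ for $\mu$-a.e. $x\in X$. Likewise, a Borel map $\phi_\omega\colon\psi^{-1}(\omega)\to Y$ is essentially $(\rho_\omega,\tau,\pi)$-equivariant if, for each $g\in G$, $\phi_\omega(\rho_\omega(g,x))=\tau(\pi(g),\phi_\omega(x))$ for $\xi(\omega)$-a.e. $x\in\psi^{-1}(\omega)$. *)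

(* Defs.v *)
From HB Require Import structures.
From mathcomp Require Import all_boot all_order all_algebra.
From mathcomp Require Import all_classical all_reals ereal topology measure.
From mathcomp Require Import lebesgue_integral.

Set Implicit Arguments.
Unset Strict Implicit.
Unset Printing Implicit Defensive.

Local Open Scope classical_set_scope.
Local Open Scope ring_scope.

HB.mixin Record isTopologicalGroup G & Topological G & Group G := {
  mulg_continuous : continuous (fun p : G * G => (p.1 * p.2)%g) ;
  invg_continuous : continuous (fun g : G => (g^-1)%g)
}.

(* Pointedness loses no generality for a group; the library's generated
   sigma-algebras, such as the Borel one below, live on pointed types. *)
#[short(type="topologicalGroupType")]
HB.structure Definition TopologicalGroup :=
  {G of PointedTopological G & Group G & isTopologicalGroup G}.

Definition borel (T : ptopologicalType) := g_sigma_algebraType (@open T).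

(* Locally compact groups are Hausdorff by convention. *)
Definition lcsc_group (G : topologicalGroupType) : Prop :=
  [/\ hausdorff_space G, locally_compact [set: G] & @second_countable G].

(* Unlike the library's [completeType], this does not force the space to be
   pointed, so that the empty metric space is allowed. *)
Definition complete_space (T : uniformType) : Prop :=
  forall F : set_system T, ProperFilter F -> cauchy F -> exists y : T, F --> y.

Definition separable_space (T : topologicalType) : Prop :=
  exists2 D : set T, countable D & dense D.

(* Isomorphic, as a measurable space, to a complete separable metric space with
   its Borel sigma-algebra. *)
Definition standard_borel (R : realType) (d : measure_display)
    (T : measurableType d) : Prop :=
  exists (P : metricType R) (f : T -> P),
    [/\ complete_space P, separable_space P, bijective f &
        forall B : set P, <<s @open P >> B <-> measurable (f @^-1` B)].

(* [f] restricted to [D] is a Borel map to [Y]. This is [measurable_fun D f]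
   for the sigma-algebra generated by the open sets, without requiring [Y] to be
   pointed. *)
Definition borel_map (d : measure_display) (X : measurableType d)
    (Y : topologicalType) (D : set X) (f : X -> Y) : Prop :=
  preimage_set_system D f <<s @open Y >> `<=` measurable.

Definition group_action (G : groupType) (T : Type) (a : G * T -> T) : Prop :=
  (forall x, a (1%g, x) = x) /\
  (forall g h x, a ((g * h)%g, x) = a (g, a (h, x))).

Definition borel_action (G : topologicalGroupType) (d : measure_display)
    (X : measurableType d) (rho : G * X -> X) : Prop :=
  group_action rho /\ measurable_fun [set: borel G * X] rho.

Definition continuous_action (H : topologicalGroupType) (Y : topologicalType)
    (tau : H * Y -> Y) : Prop :=
  group_action tau /\ continuous tau.

Section actions.
Context (R : realType) (G : groupType) (d : measure_display).
Context (X : measurableType d) (rho : G * X -> X).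

Definition quasi_invariant (m : probability X R) : Prop :=
  forall g : G,
    (pushforward m (fun x => rho (g, x)) `<< m) /\
    (m `<< pushforward m (fun x => rho (g, x))).

Definition invariant_set (A : set X) : Prop :=
  forall g : G, (fun x => rho (g, x)) @^-1` A = A.

Definition ergodic (m : probability X R) : Prop :=
  forall A : set X, measurable A -> invariant_set A ->
    m A = 0%E \/ m (~` A) = 0%E.

End actions.

(* A map [psi : X' -> Omega] is encoded by a map on the whole of [X] whose values
   off [X'] are irrelevant; this is its fibre over [w]. *)
Definition fiber (X Omega : Type) (X' : set X) (psi : X -> Omega) (w : Omega) :
  set X := X' `&` psi @^-1` [set w].

(* The measures [xi w], given on [X], are concentrated on [X'] by
   [decomp_fiber], that is, they are elements of Prob(X'). *)
Record ergodic_decomposition (R : realType) (G : groupType)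
    (d d' : measure_display) (X : measurableType d) (Omega : measurableType d')
    (rho : G * X -> X) (mu : probability X R) (nu : probability Omega R)
    (X' : set X) (psi : X -> Omega) (xi : Omega -> pprobability X R) : Prop := {
  decomp_standard : standard_borel R Omega ;
  decomp_measurable : measurable X' ;
  decomp_conull : mu (~` X') = 0%E ;
  decomp_invariant : invariant_set rho X' ;
  decomp_psi : measurable_fun X' psi ;
  decomp_psi_invariant :
    forall (g : G) (x : X), X' x -> psi (rho (g, x)) = psi x ;
  decomp_xi : measurable_fun [set: Omega] xi ;
  decomp_fiber : forall w : Omega, xi w (fiber X' psi w) = 1%E ;
  decomp_integral : forall A : set X, measurable A ->
    mu A = (\int[nu]_w xi w A)%E ;
  decomp_quasi_invariant : forall w : Omega, quasi_invariant rho (xi w) ;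
  decomp_ergodic : forall w : Omega, ergodic rho (xi w)
}.

(* Essential equivariance, for the measure [m], of a map defined on the
   [rho]-invariant set [D]; for [x] in [D], [rho (g, x)] is the value of the
   restricted action. Values of [phi] off [D] are irrelevant. *)
Definition essentially_equivariant (R : realType) (G H : groupType)
    (d : measure_display) (X : measurableType d) (Y : Type)
    (rho : G * X -> X) (tau : H * Y -> Y) (pi : G -> H)
    (D : set X) (m : probability X R) (phi : X -> Y) : Prop :=
  forall g : G,
    {ae m, forall x, D x -> phi (rho (g, x)) = tau (pi g, phi x)}.

(* Main.v *)
Require Import Defs.
From mathcomp Require Import all_boot all_order all_algebra.
From mathcomp Require Import all_classical all_reals ereal topology measure.
From mathcomp Require Import lebesgue_integral normedtype sequences.
From mathcomp Require Import measurable_realfun kernel.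
From mathcomp Require Import lra.

(* Fix a countable family f_k of Borel maps X -> Y that is dense in measure for
   every probability measure on X, and a dense sequence g_i in G.

   Equivariance under all g_i implies equivariance under G. The Borel sets of
   group elements b with x |-> phi (b x) close in measure to f_k have the
   property of Baire, and G is a Baire space, so some right translate of (g_i),
   and of any given a in G, avoids the meager set where these sets differ from
   open ones. Along the translate, b |-> phi (b x) is continuous in measure, so
   equivariance passes to the limit a; no Haar measure is needed.

   Given this, an equivariant phi for mu is equivariant under every g_i for
   almost every xi(w), hence under G. Conversely, an equivariant map for xi(w)
   is coded by a rapidly Cauchy sequence of indices k_0, k_1, ... of almost
   equivariant f_k, i.e. by a branch of a tree depending measurably on w. Such a
   branch can be chosen measurably in w off a null set, and the limit of
   f_{k_n(psi x)}(x) is the required map: each g_i-defect is null for almost all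
   xi(w), hence for mu, and the first step applies to mu. *)

Set Implicit Arguments.
Unset Strict Implicit.
Unset Printing Implicit Defensive.

Import Order.TTheory GRing.Theory Num.Theory.

Local Open Scope classical_set_scope.
Local Open Scope ring_scope.

(** * Borel maps to separable metric spaces *)

(** Powers of one half serve as standard thresholds: they are countable, so quantifiers over
    positive reals become countable unions and intersections, and they are summable, as
    Borel-Cantelli requires. *)
Definition hpow {R : realType} (k : nat) : R := 2^-1 ^+ k.

Lemma exists_hpow_lt (R : realType) (e : R) : 0 < e ->
  exists k : nat, forall j, (k <= j)%N -> hpow j < e.
Proof.
move=> e0.
have [k hk] : exists k : nat, e^-1 < k%:R.
  by exists (Num.bound e^-1); rewrite archi_boundP// invr_ge0 ltW.
exists k => j kj; rewrite /hpow exprVn invf_plt ?posrE ?exprn_gt0//.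
apply: (lt_trans hk); rewrite -natrX ltr_nat.
by apply: leq_ltn_trans kj _; exact: ltn_expl.
Qed.

Lemma hpow_le (R : realType) n k : (n <= k)%N -> hpow k <= hpow n :> R.
Proof. by move=> nk; apply: ler_wiXn2l => //; rewrite invf_le1// ler1n. Qed.

Lemma hpow_gt0 (R : realType) k : 0 < hpow k :> R.
Proof. by rewrite /hpow exprn_gt0// invr_gt0. Qed.

Lemma hpowS (R : realType) k : hpow k = hpow k.+1 + hpow k.+1 :> R.
Proof. by rewrite /hpow exprS; set e := _ ^+ k; lra. Qed.

Section metric_targets.
Context (R : realType) (Y : metricType R).

Lemma borel_mapP (d : measure_display) (X : measurableType d) (D : set X)
    (f : X -> Y) : measurable D ->
  borel_map D f <-> forall U, open U -> measurable (D `&` f @^-1` U).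
Proof.
move=> mD; split=> [bf U oU|bf _ [B sB <-]].
  by apply: bf; exists U => //; exact: sub_sigma_algebra.
suff : <<s @open Y>> `<=` [set B | measurable (D `&` f @^-1` B)] by exact.
apply: smallest_sub => //; split.
- by rewrite /= preimage_set0 setI0.
- move=> A /= mA; rewrite setTD preimage_setC.
  rewrite (_ : _ `&` _ = D `\` (D `&` f @^-1` A)); first exact: measurableD.
  by apply/seteqP; split => x /=; tauto.
- move=> F /= mF; rewrite preimage_bigcup setI_bigcupr.
  exact: bigcupT_measurable.
Qed.

Definition borel_fun (d : measure_display) (X : measurableType d)
  (f : X -> Y) := forall U, open U -> measurable (f @^-1` U).

Lemma borel_map_setT (d : measure_display) (X : measurableType d) (f : X -> Y) :
  borel_map [set: X] f <-> borel_fun f.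
Proof.
rewrite borel_mapP//; split=> h U oU; have := h _ oU; by rewrite setTI.
Qed.

Lemma open_mdist_lt (z : Y) (r : R) : open [set y | mdist y z < r].
Proof.
rewrite openE => y /= yr; apply/nbhs_ballP; exists (r - mdist y z) => /=.
  by rewrite subr_gt0.
move=> w; rewrite ballEmdist/= => yw.
apply: le_lt_trans (metric_triangle w y z) _.
by rewrite (metric_sym w y) -ltrBrDr.
Qed.

Definition dense_seq (y : nat -> Y) :=
  forall z (e : R), 0 < e -> exists n, mdist z (y n) < e.

Lemma separable_dense_seq : separable_space Y -> Y -> exists y, dense_seq y.
Proof.
move=> [D cD dD] y0.
have De z (e : R) : 0 < e -> exists2 w, D w & mdist z w < e.
  move=> e0; have [||w [/= zw Dw]] := dD [set w | mdist w z < e].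
  - by exists z; rewrite /= mdistxx.
  - exact: open_mdist_lt.
  - by exists w => //; rewrite metric_sym.
have [w0 Dw0 _] := De y0 1 ltr01.
have /pfcard_geP[D0|/unsquash s] := cD; first by rewrite D0 in Dw0.
exists s => z e /(De z)[w Dw zw].
by have [n _ sn] := @surj _ _ _ _ s w Dw; exists n; rewrite sn.
Qed.

Lemma borel_fun_cst (d : measure_display) (X : measurableType d) (z : Y) :
  borel_fun (fun _ : X => z).
Proof.
move=> U oU; have [Uz|nUz] := pselect (U z).
  by rewrite (_ : _ @^-1` _ = setT)//; apply/seteqP; split.
by rewrite (_ : _ @^-1` _ = set0)//; apply/seteqP; split.
Qed.

Section dense.
Context (y : nat -> Y) (hy : dense_seq y).
Context (d : measure_display) (X : measurableType d).
Implicit Types f g : X -> Y.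

(** When [f x] and [g x] are closer than [r], some [y n] is within [hpow k] of [f x] and within
    [r - hpow k] of [g x] for a suitable [k]. Only preimages of balls around countably many centres
    are then involved. *)
Lemma measurable_mdist_lt f g (r : R) : borel_fun f -> borel_fun g ->
  measurable [set x | mdist (f x) (g x) < r].
Proof.
move=> bf bg.
rewrite (_ : [set x | _] = \bigcup_n \bigcup_k
   (f @^-1` [set z | mdist z (y n) < hpow k] `&`
    g @^-1` [set z | mdist z (y n) < r - hpow k])).
  apply: bigcupT_measurable => n; apply: bigcupT_measurable => k.
  by apply: measurableI; [apply: bf|apply: bg]; exact: open_mdist_lt.
apply/seteqP; split=> [x /= xr|x [n _ [k _ [fx gx]]]]; last first.
  move: fx gx => /= fx gx.
  have := metric_triangle (f x) (y n) (g x); rewrite (metric_sym (y n))/=; lra.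
have [k /(_ _ (leqnn k)) hk] : exists k, forall j, (k <= j)%N ->
    hpow j < (r - mdist (f x) (g x)) / 2.
  by apply: exists_hpow_lt; rewrite divr_gt0// subr_gt0.
have [n hn] := hy (f x) (hpow_gt0 R k).
exists n => //; exists k => //; split => //=.
have := metric_triangle (g x) (f x) (y n);
rewrite (metric_sym (g x) (f x)); lra.
Qed.

Lemma measurable_mdist_ge f g (r : R) : borel_fun f -> borel_fun g ->
  measurable [set x | r <= mdist (f x) (g x)].
Proof.
move=> bf bg; rewrite (_ : [set x | _] = ~` [set x | mdist (f x) (g x) < r]).
  by apply: measurableC; exact: measurable_mdist_lt.
by apply/seteqP; split => x /=; rewrite leNgt => /negP.
Qed.

Lemma measurable_neq f g : borel_fun f -> borel_fun g ->
  measurable [set x | f x <> g x].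
Proof.
move=> bf bg.
rewrite (_ : [set x | _] = \bigcup_k [set x | hpow k <= mdist (f x) (g x)]).
  by apply: bigcupT_measurable => k; exact: measurable_mdist_ge.
apply/seteqP; split=> [x /= fg|x [k _ /= +] fg]; last first.
  by rewrite fg mdistxx leNgt hpow_gt0.
have [k /(_ _ (leqnn k)) hk] : exists k, forall j, (k <= j)%N ->
    hpow j < mdist (f x) (g x).
  by apply: exists_hpow_lt; rewrite mdist_gt0; exact/eqP.
by exists k => //=; rewrite ltW.
Qed.

Definition cauchy_at (u : nat -> Y) := forall k, exists N, forall m n,
  (N <= m)%N -> (N <= n)%N -> mdist (u m) (u n) < hpow k.

Definition tends_to (u : nat -> Y) z := forall e : R, 0 < e ->
  exists N, forall n, (N <= n)%N -> mdist (u n) z < e.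

Lemma complete_tends_to u : complete_space Y -> cauchy_at u ->
  exists z, tends_to u z.
Proof.
move=> cY cu; have [|z hz] := cY (u n @[n --> \oo]).
- apply: cauchy_exP => e e0.
  have [k /(_ _ (leqnn k)) hk] := exists_hpow_lt e0.
  have [N hN] := cu k; exists (u N), N => // n /= Nn.
  by rewrite ballEmdist/=; apply: lt_trans hk; exact: hN.
- exists z => e e0; have : nbhs z (ball z e) by exact: nbhsx_ballx.
  move=> /hz[N _ hN]; exists N => n Nn; have := hN n Nn.
  by rewrite ballEmdist/= metric_sym.
Qed.

Lemma tends_to_unique u z w : tends_to u z -> tends_to u w -> z = w.
Proof.
move=> uz uw; apply: contrapT => /eqP; rewrite -mdist_gt0 => zw.
have e0 : 0 < mdist z w / 2 by rewrite divr_gt0.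
have [N1 h1] := uz _ e0; have [N2 h2] := uw _ e0.
have := h1 (maxn N1 N2) (leq_maxl _ _); have := h2 (maxn N1 N2) (leq_maxr _ _).
have := metric_triangle z (u (maxn N1 N2)) w; rewrite (metric_sym z (u _)); lra.
Qed.

(** The Cauchy condition has countable quantifiers, so it cuts out a measurable set [C]. On [C],
    membership of the limit in an open set is a countable condition on the [u n x]; off [C] the map
    is constant. *)
Lemma borel_limit (u : nat -> X -> Y) : complete_space Y ->
    (forall n, borel_fun (u n)) ->
  exists2 phi, borel_fun phi &
    forall x, cauchy_at (u ^~ x) -> tends_to (u ^~ x) (phi x).
Proof.
move=> cY bu.
(* Where no limit exists, [xget] returns the default [y 0]. *)
pose phi x := xget (y 0%N) (tends_to (u ^~ x)).
pose C := [set x | cauchy_at (u ^~ x)].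
have phiC x : C x -> tends_to (u ^~ x) (phi x).
  by move=> /(complete_tends_to cY) ?; exact: xgetPex.
have phiN x : ~ C x -> phi x = y 0%N.
  move=> nC; apply: xgetPN => z uz; apply: nC => k.
  have [N hN] := uz _ (hpow_gt0 R k.+1); exists N => m n Nm Nn.
  have := hN _ Nm; have := hN _ Nn; have := metric_triangle (u m x) z (u n x).
  by rewrite (metric_sym z) (hpowS R k); lra.
have mC : measurable C.
  rewrite (_ : C = \bigcap_k \bigcup_N \bigcap_m \bigcap_n
     [set x | (N <= m)%N -> (N <= n)%N ->
        mdist (u m x) (u n x) < hpow k]).
    apply: bigcapT_measurable => k; apply: bigcupT_measurable => N.
    apply: bigcapT_measurable => m; apply: bigcapT_measurable => n.
    have [Nm|Nm] := boolP (N <= m)%N; last first.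
      by rewrite (_ : [set x | _] = setT)//; apply/seteqP; split.
    have [Nn|Nn] := boolP (N <= n)%N; last first.
      by rewrite (_ : [set x | _] = setT)//; apply/seteqP; split.
    rewrite (_ : [set x | _] = [set x | mdist (u m x) (u n x) < hpow k]).
      exact: measurable_mdist_lt.
    by apply/seteqP; split => x /=; auto.
  apply/seteqP; split => x.
    by move=> h k _; have [N hN] := h k; exists N => // m _ n _; exact: hN.
  by move=> h k; have [N _ hN] := h k I; exists N => m n; exact: hN.
exists phi => // U oU.
(* [V k] is the [hpow k]-neighbourhood of the complement of [U]. Since [U] is open, a limit lies in
   [U] exactly when, for some [k], the sequence eventually avoids [V k]. *)
pose V k := [set z | exists2 w, ~ U w & mdist z w < hpow k].
have oV k : open (V k).
  rewrite (_ : V k = \bigcup_(w in ~` U) [set z | mdist z w < hpow k]).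
    by apply: bigcup_open => w _; exact: open_mdist_lt.
  by apply/seteqP; split => z [w]; exists w.
rewrite (_ : phi @^-1` U = (C `&` \bigcup_k \bigcup_N \bigcap_n
    [set x | (N <= n)%N -> ~ V k (u n x)]) `|`
    (~` C `&` (fun=> y 0%N) @^-1` U)); last first.
  apply/seteqP; split=> [x /= Ux|x]; last first.
    case=> -[Cx]; last by rewrite /= phiN.
    move=> [k _ [N _ hN]]; apply: contrapT => /= nUx.
    have [M hM] := phiC _ Cx _ (hpow_gt0 R k).
    apply: (hN (maxn N M) I (leq_maxl _ _)).
    by exists (phi x) => //; apply: hM; exact: leq_maxr.
  have [Cx|nCx] := pselect (C x); last by right; split=> //=; rewrite -(phiN x).
  left; split => //.
  have /nbhs_ballP[e /= e0 he] : nbhs (phi x) U by exact: open_nbhs_nbhs.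
  have [k /(_ _ (leqnn k)) hk] : exists k, forall j, (k <= j)%N ->
    hpow j < e / 2 by apply: exists_hpow_lt; rewrite divr_gt0.
  exists k => //; have [|N hN] := phiC _ Cx (e / 2); first by rewrite divr_gt0.
  exists N => // n _ /= Nn [w nUw uw]; apply: nUw; apply: he.
  rewrite ballEmdist/=; have := hN _ Nn.
  have := metric_triangle (phi x) (u n x) w;
  rewrite (metric_sym (phi x) (u n x)).
  lra.
apply: measurableU; apply: measurableI => //.
- apply: bigcupT_measurable => k; apply: bigcupT_measurable => N.
  apply: bigcapT_measurable => n.
  have [Nn|Nn] := boolP (N <= n)%N; last first.
    by rewrite (_ : [set x | _] = setT)//; apply/seteqP; split.
  rewrite (_ : [set x | _] = ~` (u n @^-1` V k)).
    by apply: measurableC; exact: bu.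
  by apply/seteqP; split => x /=; auto.
- exact: measurableC.
- exact: borel_fun_cst.
Qed.

End dense.
End metric_targets.

(** * Measurable hulls and measurable selection *)

Section probability_lemmas.
Context (R : realType) (d : measure_display) (X : measurableType d).
Context (m : probability X R).

Lemma measure_sub (A B : set X) : measurable A -> measurable B -> A `<=` B ->
  (m A <= m B)%E.
Proof. by move=> mA mB AB; apply: le_measure; rewrite ?inE. Qed.

Lemma measure_subU_lt (A B C : set X) (a b : R) : measurable A ->
    measurable B -> measurable C -> C `<=` A `|` B ->
  (m A < a%:E -> m B < b%:E -> m C < (a + b)%:E)%E.
Proof.
move=> mA mB mC CAB Aa Bb.
apply: (@le_lt_trans _ _ (m A + m B)%E); last by rewrite EFinD lteD.
apply: (@le_trans _ _ (m (A `|` B))); last exact: measureU2.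
by apply: measure_sub => //; exact: measurableU.
Qed.

(** Borel-Cantelli: the measures are dominated by a geometric series of sum 2. *)
Lemma measure_lim_sup_set0 (B : nat -> set X) :
    (forall n, measurable (B n)) ->
    (forall n, (m (B n) < (hpow n)%:E)%E) ->
  m (lim_sup_set B) = 0%E.
Proof.
move=> mB Bn; apply: lim_sup_set_cvg0 => //.
apply: (@le_lt_trans _ _ (2 : R)%:E); last exact: ltry.
have := @epsilon_trick0 R 2 xpredT ltac:(by []).
apply: le_trans; apply: lee_nneseries => // n _.
apply: (le_trans (ltW (Bn n))).
by rewrite lee_fin /hpow natrX exprVn exprS invfM mulrA divff ?mul1r.
Qed.

(** The tail unions decrease to the limsup, so continuity from above applies. This turns convergence
    almost everywhere into convergence in measure. *)
Lemma lim_sup_set0_small (B : nat -> set X) (e : R) :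
    (forall n, measurable (B n)) -> m (lim_sup_set B) = 0%E -> 0 < e ->
  exists N, forall n, (N <= n)%N -> (m (B n) < e%:E)%E.
Proof.
move=> mB B0 e0.
have mU n : measurable (\bigcup_(k >= n) B k) by exact: bigcup_measurable.
have fin : (m (\bigcup_(k in [set k | (0 <= k)%N]) B k) < +oo)%E.
  by apply: (@le_lt_trans _ _ 1%E); [exact: probability_le1|exact: ltry].
have := @lim_sup_set_cvg _ _ _ m B mB fin; rewrite [X in _ --> X]B0.
move=> cv; have [N _ hN] :
    \forall n \near \oo, (m (\bigcup_(k >= n) B k) < e%:E)%E.
  exact: (cv _ (@nbhs_open_ereal_lt R 0 (fun=> e) e0)).
exists N => n Nn; apply: (le_lt_trans _ (hN n Nn)).
by apply: measure_sub => //; move=> x Bx; exists n => /=.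
Qed.

Lemma lim_sup_setP (B : nat -> set X) x :
  ~ lim_sup_set B x <-> exists N, forall n, (N <= n)%N -> ~ B n x.
Proof.
split=> [h|[N hN] h]; last first.
  by have [n /= Nn Bn] := h N I; exact: hN Nn Bn.
apply: contrapT => /forallNP h'; apply: h => N _.
by have /existsNP[n /not_implyP[Nn /contrapT Bn]] := h' N; exists n.
Qed.

Lemma measurable_lim_sup (B : nat -> set X) :
  (forall n, measurable (B n)) -> measurable (lim_sup_set B).
Proof.
move=> mB; apply: bigcapT_measurable => n; exact: bigcup_measurable.
Qed.

End probability_lemmas.

Section hull.
Context (R : realType) (d : measure_display) (X : measurableType d).
Context (m : probability X R).

(** The hull is an intersection of measurable supersets whose measures approach the infimum. Cutting
    it with a further measurable superset [M] gives again a superset of [F], which cannot have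
    smaller measure. *)
Lemma measurable_hull (F : set X) : exists H, [/\ measurable H, F `<=` H &
  forall M, measurable M -> F `<=` M -> m (H `\` M) = 0%E].
Proof.
pose S := [set fine (m M) | M in [set M | measurable M /\ F `<=` M]].
have infS : has_inf S.
  split; first by exists (fine (m setT)), setT.
  by exists 0 => _ [M _ <-]; rewrite fine_ge0.
have /choice[M hM] : forall n, exists M, [/\ measurable M, F `<=` M &
    fine (m M) < inf S + hpow n].
  move=> n; have [_ [M [mM FM] <-] h] := inf_adherent (hpow_gt0 R n) infS.
  by exists M.
have mH : measurable (\bigcap_n M n).
  by apply: bigcapT_measurable => n; have [] := hM n.
have FH : F `<=` \bigcap_n M n.
  by move=> x Fx n _; have [_ + _] := hM n; exact.
exists (\bigcap_n M n); split=> // N mN FN; set H := \bigcap_n M n.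
have -> : m (H `\` N) = (m H - m (H `&` N))%E.
  by rewrite measureD// ltey_eq fin_num_measure.
have HNH : (m (H `&` N) <= m H)%E.
  by apply: measure_sub => //; exact: measurableI.
apply/eqP; rewrite eq_le sube_ge0 ?fin_num_measure// ?HNH ?andbT; last first.
  exact: measurableI.
apply/lee_addgt0Pr => e /exists_hpow_lt[n /(_ _ (leqnn n)) hn].
have HN : inf S <= fine (m (H `&` N)).
  apply: ge_inf; first exact: infS.2.
  exists (H `&` N) => //; split; first exact: measurableI.
  by move=> x Fx; split; [exact: FH|exact: FN].
have HM : fine (m H) <= fine (m (M n)).
  have [mM _ _] := hM n.
  apply: fine_le; rewrite ?fin_num_measure//.
  by apply: measure_sub => //; exact: bigcap_inf.
have [_ _ Mn] := hM n.
rewrite -(@fineK _ (m H)) ?fin_num_measure//.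
rewrite -(@fineK _ (m (H `&` N))) ?fin_num_measure//; last exact: measurableI.
rewrite -EFinB add0e lee_fin; lra.
Qed.

End hull.

Section selection.
Context (R : realType) (d : measure_display) (X : measurableType d).
Context (m : probability X R).

Lemma measurable_least (Q : nat -> set X) : (forall n, measurable (Q n)) ->
  exists2 c : X -> nat, (forall n, measurable (c @^-1` [set n])) &
    forall x, (exists n, Q n x) -> Q (c x) x.
Proof.
move=> mQ.
pose D n := Q n `\` \big[setU/set0]_(i < n) Q i.
have mD n : measurable (D n).
  by apply: measurableD => //; apply: bigsetU_measurable.
have DP n x : D n x <-> Q n x /\ forall i, (i < n)%N -> ~ Q i x.
  rewrite /D /= -bigcup_mkord; split=> -[Qn h]; split=> //.
    by move=> i ni Qi; apply: h; exists i.
  by move=> [i /= ni]; exact: h.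
have Dex x : (exists n, Q n x) -> exists n, D n x.
  move=> [n Qn].
  have ex : exists n, `[< Q n x >] by exists n; apply/asboolP.
  exists (ex_minn ex); apply/DP; case: ex_minnP => k /asboolP Qk mink.
  split=> // i ik Qi; have := mink i (asboolT Qi).
  by rewrite leqNgt ik.
have Duniq x n k : D n x -> D k x -> n = k.
  move=> /DP[Qn hn] /DP[Qk hk]; have [nk|kn|//] := ltngtP n k.
    by case: (hk _ nk).
  by case: (hn _ kn).
exists (fun x => xget 0%N [set n | D n x]); last first.
  by move=> x /Dex Dx; have [] := @xgetPex _ 0%N [set n | D n x] Dx.
move=> n.
(* Points lying in no [Q k] receive the default value 0, so they have to be added to the preimage of
   0. *)
rewrite (_ : _ @^-1` _ = D n `|`
    (if n == 0%N then ~` \bigcup_k D k else set0)).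
  apply: measurableU => //; case: ifP => // _.
  by apply: measurableC; exact: bigcupT_measurable.
apply/seteqP; split=> x /=.
  case: xgetP => [k -> Dk <-|hn <-]; first by left.
  by rewrite eqxx; right => -[k _] /hn.
case=> [Dn|].
  by apply: (Duniq x) => //; apply: (@xgetPex _ 0%N [set n | D n x]); exists n.
case: eqP => // -> nD; rewrite xgetPN// => k Dk; apply: nD; by exists k.
Qed.

(* The set [F k a] of points from which a branch can be continued is in general
   only analytic; the proof works with measurable hulls of these sets, which
   satisfy the same recursive inclusion up to a null set. *)
Lemma measurable_branch (P : nat -> nat -> nat -> set X) :
    (forall k a b, measurable (P k a b)) ->
    {ae m, forall x, exists b, forall k, P k (b k) (b k.+1) x} ->
  exists c : nat -> X -> nat,
    (forall k n, measurable (c k @^-1` [set n])) /\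
    {ae m, forall x, forall k, P k (c k x) (c k.+1 x) x}.
Proof.
move=> mP [N0 [mN0 N00 hN0]].
pose F k a := [set x | exists b : nat -> nat, b 0%N = a /\
   forall j, P (k + j)%N (b j) (b j.+1) x].
have /choice[H hH] : forall ka, exists H, [/\ measurable H, F ka.1 ka.2 `<=` H &
    forall M, measurable M -> F ka.1 ka.2 `<=` M -> m (H `\` M) = 0%E].
  by move=> ka; exact: measurable_hull.
pose Q k a b := P k a b `&` H (k.+1, b).
have mH k a : measurable (H (k, a)) by have [] := hH (k, a).
have mQ k a b : measurable (Q k a b) by exact: measurableI.
(* The first step of a branch lands in the next [F], hence in its hull. The right-hand side is
   measurable, so it also contains the hull of [F k a] up to a null set; this is [nHQ]. *)
have FQ k a : F k a `<=` \bigcup_b Q k a b.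
  move=> x [b [<- hb]]; exists (b 1%N) => //; split.
    by have := hb 0%N; rewrite addn0.
  have [_ + _] := hH (k.+1, b 1%N); apply; exists (fun j => b j.+1).
  by split=> // j; have := hb j.+1; rewrite addnS.
have nHQ k a : m (H (k, a) `\` \bigcup_b Q k a b) = 0%E.
  by have [_ _] := hH (k, a); apply=> //; exact: bigcupT_measurable.
have mD k a : measurable (H (k, a) `\` \bigcup_b Q k a b).
  by apply: measurableD => //; exact: bigcupT_measurable.
have mDU : measurable (\bigcup_k \bigcup_a (H (k, a) `\` \bigcup_b Q k a b)).
  by apply: bigcupT_measurable => k; exact: bigcupT_measurable.
have [c0 mc0 hc0] := measurable_least (mH 0%N).
have /choice[c hc] : forall ka, exists c : X -> nat,
    (forall n, measurable (c @^-1` [set n])) /\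
    forall x, (exists b, Q ka.1 ka.2 b x) -> Q ka.1 ka.2 (c x) x.
  by move=> ka; have [c] := measurable_least (mQ ka.1 ka.2); exists c.
(* Each choice is made inside [Q], hence stays in the hull of the next level. Off the null sets of
   [nHQ] the greedy selection therefore never gets stuck. *)
pose s := fix s k x := if k is j.+1 then c (j, s j x) x else c0 x.
exists s; split.
  elim=> [|k IH] n; first exact: mc0.
  rewrite (_ : _ @^-1` _ =
      \bigcup_a (s k @^-1` [set a] `&` c (k, a) @^-1` [set n])).
    apply: bigcupT_measurable => a; apply: measurableI; first exact: IH.
    by have [] := hc (k, a).
  apply/seteqP; split=> x /=; first by move=> h; exists (s k x).
  by move=> [a _ [/= <-]].
exists (N0 `|` \bigcup_k \bigcup_a (H (k, a) `\` \bigcup_b Q k a b)); split.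
- exact: measurableU.
- apply/negligibleP; first exact: measurableU.
  apply: negligibleU; first exact/negligibleP.
  apply: negligible_bigcup => k; apply: negligible_bigcup => a.
  by apply/negligibleP => //; exact: nHQ.
- move=> x; apply: contra_notP => /not_orP[nN0 nN] k.
  have nN' j a : H (j, a) x -> exists b, Q j a b x.
    move=> Hx; apply: contrapT => nQ; apply: nN; exists j => //; exists a => //.
    by split=> // -[b _ Qb]; apply: nQ; exists b.
  have [b hb] : exists b, forall k, P k (b k) (b k.+1) x.
    by apply: contrapT => /hN0.
  have Hs j : H (j, s j x) x.
    elim: j => [|j IH] /=.
      apply: hc0; exists (b 0%N).
      by have [_ + _] := hH (0%N, b 0%N); apply; exists b.
    by have [_ /(_ x (nN' _ _ IH))[]] := hc (j, s j x).
  by have [_ /(_ x (nN' _ _ (Hs k)))[]] := hc (k, s k x).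
Qed.

End selection.

(** * Density of simple maps in measure *)

(** The generators are the preimages of the balls of radius [hpow k] around the points of a dense
    sequence; an open set is the union of those of these balls that it contains. *)
Lemma standard_borel_countably_generated (R : realType) (d : measure_display)
    (X : measurableType d) : standard_borel R X ->
  exists B : nat -> set X, (forall n, measurable (B n)) /\
    measurable `<=` <<s range B>>.
Proof.
move=> [P [f [_ sP [g gf fg] fB]]].
have [p hp] := separable_dense_seq sP (f point).
pose B n := if unpickle n is Some (i, k) then
  f @^-1` [set z | mdist z (p i) < hpow k] else set0.
exists B; split=> [n|A mA].
  rewrite /B; case: unpickle => // -[i k]; apply/fB.
  by apply: sub_sigma_algebra; exact: open_mdist_lt.
have -> : A = f @^-1` (g @^-1` A).
  by apply/seteqP; split=> x /=; rewrite gf.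
have : <<s @open P>> (g @^-1` A).
  apply/fB; rewrite (_ : _ @^-1` _ = A)//.
  by apply/seteqP; split=> x /=; rewrite gf.
suff : <<s @open P>> `<=` [set C | <<s range B>> (f @^-1` C)] by exact.
have [s0 sC sU] := smallest_sigma_algebra setT (range B).
apply: smallest_sub => [|U oU /=].
  split=> /=.
  - by rewrite preimage_set0.
  - by move=> C /= hC; rewrite setTD preimage_setC -setTD; exact: sC.
  - by move=> F hF; rewrite preimage_bigcup; exact: sU.
rewrite (_ : f @^-1` U = \bigcup_n
   (if `[< B n `<=` f @^-1` U >] then B n else set0)).
  apply: sU => n; case: ifP => // _.
  by apply: sub_sigma_algebra; exists n.
apply/seteqP; split=> [x /= Ux|x [n _]]; last first.
  by case: ifP => //= /asboolP; exact.
have /nbhs_ballP[e /= e0 he] : nbhs (f x) U by exact: open_nbhs_nbhs.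
have [k /(_ _ (leqnn k)) hk] : exists k, forall j, (k <= j)%N ->
  hpow j < e / 2 by apply: exists_hpow_lt; rewrite divr_gt0.
have [i hi] := hp (f x) _ (hpow_gt0 R k).
exists (pickle (i, k)) => //; rewrite ifT /B ?pickleK//.
apply/asboolP => w /= wi.
apply: he; rewrite ballEmdist/=.
have := metric_triangle (f x) (p i) (f w); rewrite (metric_sym (p i)); lra.
Qed.

Definition symdiff (T : Type) (A C : set T) := (A `\` C) `|` (C `\` A).

Section algebra.
Context (T : Type) (B : nat -> set T).

(** Formal Boolean combinations of the sets [B n]. Encoding them as finite trees makes them
    countable, which enumerates the algebra generated by [B]. *)
Inductive bool_term := bvar of nat | bnot of bool_term
  | bor of bool_term & bool_term.

Fixpoint bool_term_eval t := match t with
  | bvar n => B n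
  | bnot t => ~` bool_term_eval t
  | bor t u => bool_term_eval t `|` bool_term_eval u
  end.

Fixpoint bool_term_encode t := match t with
  | bvar n => GenTree.Leaf n
  | bnot t => GenTree.Node 0 [:: bool_term_encode t]
  | bor t u => GenTree.Node 1 [:: bool_term_encode t; bool_term_encode u]
  end.

Fixpoint bool_term_decode t := match t with
  | GenTree.Leaf n => bvar n
  | GenTree.Node 0 [:: t] => bnot (bool_term_decode t)
  | GenTree.Node _ [:: t; u] => bor (bool_term_decode t) (bool_term_decode u)
  | _ => bvar 0
  end.

Lemma bool_term_encodeK : cancel bool_term_encode bool_term_decode.
Proof. by elim=> //= [t ->|t -> u ->]. Qed.

Lemma countable_algebra : exists E : nat -> set T,
  [/\ forall n, exists k, E k = B n, forall n, exists k, E k = ~` E n,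
      forall n k, exists l, E l = E n `|` E k &
      forall S : set (set T), (forall n, S (B n)) ->
        (forall A, S A -> S (~` A)) ->
        (forall A C, S A -> S C -> S (A `|` C)) ->
      forall n, S (E n)].
Proof.
pose c n := if unpickle n is Some t then bool_term_decode t else bvar 0.
have cE t : c (pickle (bool_term_encode t)) = t.
  by rewrite /c pickleK bool_term_encodeK.
exists (fun n => bool_term_eval (c n)); split.
- by move=> n; exists (pickle (bool_term_encode (bvar n))); rewrite cE.
- by move=> n; exists (pickle (bool_term_encode (bnot (c n)))); rewrite cE.
- move=> n k; exists (pickle (bool_term_encode (bor (c n) (c k)))).
  by rewrite cE.
- by move=> S SB SC SU n; elim: (c n) => //= [t /SC//|t ? u ?]; exact: SU.
Qed.

End algebra.

Section approximation.
Context (R : realType) (d : measure_display) (X : measurableType d).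
Context (B : nat -> set X) (mB : forall n, measurable (B n)).
Context (gB : measurable `<=` <<s range B>>).

Lemma measurable_symdiff (A C : set X) : measurable A -> measurable C ->
  measurable (symdiff A C).
Proof. by move=> mA mC; apply: measurableU; exact: measurableD. Qed.

(** The sets that can be approximated by members of the algebra form a sigma-algebra containing
    every [B n]. The sequence [E] is chosen before [m], so it serves all measures at once. *)
Lemma approximating_algebra : exists E : nat -> set X,
  (forall n, measurable (E n)) /\
  forall (m : probability X R) (A : set X) (e : R), measurable A -> 0 < e ->
    exists k, (m (symdiff A (E k)) < e%:E)%E.
Proof.
have [E [EB EC EU ES]] := countable_algebra B.
have mE : forall n, measurable (E n).
  apply: ES => // [A|A C]; [exact: measurableC|exact: measurableU].
exists E; split=> // m A e mA e0.
pose S := [set A | measurable A /\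
  forall e : R, 0 < e -> exists k, (m (symdiff A (E k)) < e%:E)%E].
suff SS : <<s range B>> `<=` S by have [_] := SS _ (gB mA); exact.
have E0 : exists k, E k = set0.
  have [k hk] := EC 0%N; have [l hl] := EU 0%N k; have [n hn] := EC l.
  by exists n; rewrite hn hl hk setUv setCT.
have S0 : S set0.
  split=> // r r0; have [k hk] := E0; exists k.
  by rewrite hk /symdiff !set0D set0U measure0 lte_fin.
apply: smallest_sub => [|_ [n _ <-]]; last first.
  split=> // r r0; have [k Ek] := EB n; exists k.
  by rewrite Ek /symdiff setDv set0U measure0 lte_fin.
split=> //.
- move=> C [mC hC]; rewrite setTD; split; first exact: measurableC.
  move=> r /hC[k hk]; have [l El] := EC k; exists l.
  rewrite El (_ : symdiff _ _ = symdiff C (E k))//.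
  by rewrite /symdiff !setDE !setCK setUC [X in X `|` _]setIC
    [X in _ `|` X]setIC.
- move=> F hF; have mF n : measurable (F n) by have [] := hF n.
  have fin n (r : R) : 0 < r -> exists k,
      (m (symdiff (\big[setU/set0]_(i < n) F i) (E k)) < r%:E)%E.
    elim: n r => [|n IH] r r0; first by rewrite big_ord0; exact: S0.2.
    have r20 : 0 < r / 2 by rewrite divr_gt0.
    have [k hk] := IH _ r20; have [l hl] := (hF n).2 _ r20.
    have [j Ej] := EU k l; exists j; rewrite Ej big_ord_recr/=.
    have mb : measurable (\big[setU/set0]_(i < n) F i).
      exact: bigsetU_measurable.
    have := measure_subU_lt (measurable_symdiff mb (mE k))
      (measurable_symdiff (mF n) (mE l)) _ _ hk hl.
    rewrite -splitr; apply.
      by apply: measurable_symdiff; exact: measurableU.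
    by rewrite /symdiff => x /=; tauto.
  have mU : measurable (\bigcup_n F n) by exact: bigcupT_measurable.
  split=> // r r0; have r20 : 0 < r / 2 by rewrite divr_gt0.
  (* The part of the union missed by its first [n] terms decreases to the empty set, so a finite
     subunion suffices up to measure [r / 2]. *)
  pose D n := (\bigcup_n F n) `\` \big[setU/set0]_(i < n) F i.
  have mb n : measurable (\big[setU/set0]_(i < n) F i).
    exact: bigsetU_measurable.
  have mD n : measurable (D n) by exact: measurableD.
  have [|N /(_ _ (leqnn N)) hN] := lim_sup_set0_small (m := m) mD _ r20.
    rewrite (_ : lim_sup_set D = set0) ?measure0//; apply/seteqP; split=> // x.
    suff : ~ lim_sup_set D x by [].
    apply/lim_sup_setP; have [[n _ Fn]|nF] := pselect ((\bigcup_n F n) x).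
      exists n.+1 => k nk [_]; rewrite -bigcup_mkord; apply.
      by exists n => //=.
    by exists 0%N => n _ [].
  have [k hk] := fin N _ r20; exists k.
  have := measure_subU_lt (mD N) (measurable_symdiff (mb N) (mE k)) _ _ hN hk.
  rewrite -splitr; apply; first exact: measurable_symdiff.
  rewrite /symdiff /D -bigcup_mkord => x /=.
  have : (\bigcup_(i in `I_N) F i) `<=` \bigcup_n F n.
    by move=> z [i _ Fz]; exists i.
  have := pselect ((\bigcup_(i in `I_N) F i) x).
  by move=> + /(_ x); tauto.
Qed.

Context (Y : metricType R) (y : nat -> Y) (hy : dense_seq y).

(** The sequence precedes the quantifier over [m]: the same indices can then code maps for all the
    measures [xi w], which makes a measurable choice in [w] meaningful. *)
Definition dense_in_measure (f : nat -> X -> Y) :=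
  forall (m : probability X R) (phi : X -> Y) (e : R), borel_fun phi -> 0 < e ->
    exists k, (m [set x | (e <= mdist (phi x) (f k x))%R] < e%:E)%E.

(** A Borel map is close, off a small set, to a step map with values among finitely many [y q]; its
    level sets are then replaced by sets from the countable algebra. *)
Lemma dense_borel_seq : exists f : nat -> X -> Y,
  (forall k, borel_fun (f k)) /\ dense_in_measure f.
Proof.
have [E [mE hE]] := approximating_algebra.
(* [F s x] is the position in the list [s] of the first index whose set contains [x], or the length
   of [s] if there is none. Taking first positions makes the step map well defined even when the
   sets overlap. *)
pose F (s : seq nat) x := find (fun j => `[< E j x >]) s.
have mF (s : seq nat) (P : nat -> Prop) : measurable [set x | P (F s x)].
  elim: s P => [|j s IH] P.
    rewrite /F/=; have [P0|P0] := pselect (P 0%N).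
      by rewrite (_ : [set x | _] = setT)//; apply/seteqP; split.
    by rewrite (_ : [set x | _] = set0)//; apply/seteqP; split.
  rewrite (_ : [set x | _] = (E j `&` [set x | P 0%N]) `|`
     (~` E j `&` [set x | P (F s x).+1])).
    apply: measurableU; apply: measurableI => //.
    - have [P0|P0] := pselect (P 0%N).
        by rewrite (_ : [set x | _] = setT)//; apply/seteqP; split.
      by rewrite (_ : [set x | _] = set0)//; apply/seteqP; split.
    - exact: measurableC.
    - exact: (IH (fun n => P n.+1)).
  apply/seteqP; split=> x; rewrite /F /=; case: asboolP => Ex; tauto.
pose f k x := y (F (odflt [::] (unpickle k)) x).
have bf k : borel_fun (f k).
  by move=> U oU; exact: (mF _ (fun n => U (y n))).
exists f; split=> // m phi e bphi e0.
have e20 : 0 < e / 2 by rewrite divr_gt0.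
pose V q := [set x | mdist (phi x) (y q) < e].
have mV q : measurable (V q) by exact: (bphi _ (open_mdist_lt (y q) e)).
(* [A q] consists of the points for which [y q] is the first value within [e] of [phi x]; [D n]
   consists of those for which none of the first [n] values is. *)
pose A q := V q `\` \big[setU/set0]_(p < q) V p.
have mA q : measurable (A q).
  by apply: measurableD => //; exact: bigsetU_measurable.
pose D n := ~` \big[setU/set0]_(p < n) V p.
have mD n : measurable (D n).
  by apply: measurableC; exact: bigsetU_measurable.
have [|N /(_ _ (leqnn N)) hN] := lim_sup_set0_small (m := m) mD _ e20.
  rewrite (_ : lim_sup_set D = set0) ?measure0//; apply/seteqP; split=> // x.
  suff : ~ lim_sup_set D x by [].
  apply/lim_sup_setP; have [n hn] := hy (phi x) e0.
  exists n.+1 => k nk; rewrite /D -bigcup_mkord => nD; apply: nD.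
  by exists n => //=.
pose sd (s : seq nat) p := symdiff (A p) (E (nth 0%N s p)).
pose S s n := \big[setU/set0]_(p < n) sd s p.
have mS s n : measurable (S s n).
  by apply: bigsetU_measurable => p _; exact: measurable_symdiff.
have [s [sN hs]] : exists s, size s = N /\ (m (S s N) < (e / 2)%:E)%E.
  elim: N (e / 2) e20 {hN} => [|n IH] r r0.
    by exists [::]; rewrite /S big_ord0 measure0 lte_fin.
  have r20 : 0 < r / 2 by rewrite divr_gt0.
  have [s [sn hs]] := IH _ r20; have [k hk] := hE m (A n) _ (mA n) r20.
  exists (rcons s k); split; first by rewrite size_rcons sn.
  have := measure_subU_lt (mS s n) (measurable_symdiff (mA n) (mE k)) _ _ hs hk.
  rewrite -splitr; apply => //.
  rewrite /S big_ord_recr/= {2}/sd nth_rcons sn ltnn eqxx.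
  rewrite (eq_bigr (fun p : 'I_n => sd s p))// => p _.
  by rewrite /sd nth_rcons sn ltn_ord.
exists (pickle s).
have := measure_subU_lt (mD N) (mS s N) _ _ hN hs; rewrite -splitr; apply.
  exact: (measurable_mdist_ge hy).
move=> x /= hx; apply: contrapT => /not_orP[/contrapT DN SN].
have [q [qN Vq hq]] : exists q, [/\ (q < N)%N, V q x &
    forall p, (p < q)%N -> ~ V p x].
  move: DN; rewrite -bigcup_mkord => -[q /= qN Vq].
  have ex : exists p, `[< V p x >] by exists q; apply/asboolP.
  case: (ex_minnP ex) => p /asboolP Vp minp; exists p; split=> //.
    by apply: leq_ltn_trans qN; apply: minp; apply/asboolP.
  by move=> i ip /asboolP/minp; rewrite leqNgt ip.
have Aq : A q x by split=> //; rewrite -bigcup_mkord => -[p /= /hq].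
have nA p : (p < q)%N -> ~ A p x by move=> /hq nV [].
have AE p : (p < N)%N -> A p x <-> E (nth 0%N s p) x.
  move=> pN; have : ~ symdiff (A p) (E (nth 0%N s p)) x.
    by move=> h; apply: SN; rewrite /S -bigcup_mkord; exists p.
  rewrite /symdiff /=.
  by have := pselect (A p x); have := pselect (E (nth 0%N s p) x); tauto.
have Fq : F s x = q.
  have hasE : has (fun j => `[< E j x >]) s.
    apply/(has_nthP 0%N); exists q; rewrite ?sN//.
    by apply/asboolP/AE.
  apply/eqP; rewrite eqn_leq; apply/andP; split; rewrite leqNgt; apply/negP.
    move=> /(before_find 0%N) /asboolP; apply; exact/AE.
  move=> Fq; have := nth_find 0%N hasE => /asboolP.
  by move=> /AE h; apply: (nA _ Fq); apply: h; exact: ltn_trans qN.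
move: hx; rewrite /f pickleK/= Fq.
by move: Vq; rewrite /V /= ltNge => /negP.
Qed.

End approximation.

(** * Baire category *)

Section category.
Context (T : topologicalType).

Definition nowhere_dense_closed (F : set T) :=
  closed F /\ forall U, open U -> U !=set0 -> ~ U `<=` F.

Definition meager (M : set T) := exists2 F : nat -> set T,
  (forall n, nowhere_dense_closed (F n)) & M `<=` \bigcup_n F n.

Lemma meagerS (M N : set T) : M `<=` N -> meager N -> meager M.
Proof. by move=> MN [F hF NF]; exists F => //; exact: subset_trans NF. Qed.

Lemma nowhere_dense_closed0 : nowhere_dense_closed set0.
Proof. by split; [exact: closed0|move=> U _ [x Ux] /(_ x Ux)]. Qed.

Lemma meager0 : meager set0.
Proof. by exists (fun=> set0) => // _; exact: nowhere_dense_closed0. Qed.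

Lemma meager_bigcup (M : nat -> set T) : (forall n, meager (M n)) ->
  meager (\bigcup_n M n).
Proof.
move=> hM.
have /choice[F hF] : forall n, exists F : nat -> set T,
    (forall k, nowhere_dense_closed (F k)) /\ M n `<=` \bigcup_k F k.
  by move=> n; have [F] := hM n; exists F.
exists (fun n => if unpickle n is Some (i, k) then F i k else set0).
  move=> n; case: unpickle => [[i k]|]; last exact: nowhere_dense_closed0.
  by have [] := hF i.
move=> x [n _ Mx]; have [_ /(_ x Mx)[k _ Fx]] := hF n.
by exists (pickle (n, k)) => //; rewrite pickleK.
Qed.

Lemma meagerU (M N : set T) : meager M -> meager N -> meager (M `|` N).
Proof.
move=> mM mN; rewrite -bigcup2E; apply: meager_bigcup => -[|[|n]]//=.
exact: meager0.
Qed.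

Lemma meager_preimage (h k : T -> T) (M : set T) : continuous h ->
  continuous k -> cancel h k -> cancel k h -> meager M -> meager (h @^-1` M).
Proof.
move=> ch ck hk kh [F hF MF]; exists (fun n => h @^-1` F n).
  move=> n; have [cF nF] := hF n; split.
    by apply: closed_comp => // x _; exact: ch.
  move=> U oU [x Ux] UF; apply: (nF (k @^-1` U)).
  - by apply: open_comp => // y _; exact: ck.
  - by exists (h x); rewrite /= hk.
  - by move=> y /UF /=; rewrite kh.
by move=> x /MF[n _ Fx]; exists n.
Qed.

(** Inside a compact neighbourhood, nonempty open sets are nested so that the closure of each avoids
    one more [F n]. A cluster point of points picked in them lies in all the closures. *)
Lemma locally_compact_baire (M : set T) (x0 : T) : hausdorff_space T ->
  locally_compact [set: T] -> meager M -> exists x, ~ M x.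
Proof.
move=> hT lcT [F hF MF].
have [K x0K [cK clK]] : exists2 K : set T, nbhs x0 K & compact K /\ closed K.
  have [K] := lcT x0 I; rewrite withinET => x0K cK; by exists K.
pose good (V : set T) := [/\ open V, V !=set0 & V `<=` K].
have step V n : good V -> exists W, good W /\ closure W `<=` V `\` F n.
  move=> [oV V0 VK]; have [cF nF] := hF n.
  have [x [Vx nFx]] : exists x, V x /\ ~ F n x.
    by apply: contrapT => h; apply: (nF V oV V0) => x Vx;
      apply: contrapT => nFx; apply: h; exists x.
  have VF : nbhs x (V `\` F n).
    apply: open_nbhs_nbhs; split => //; rewrite setDE.
    by apply: openI => //; exact: closed_openC.
  have Kx : nbhs x K by apply: filterS VK _; exact: open_nbhs_nbhs.
  have [W Wx hW] := compact_regular hT cK Kx VF.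
  exists (interior W); split.
    split; first exact: open_interior.
    - by exists x; exact: Wx.
    - move=> y /interior_subset /(@subset_closure _ W) /hW[Vy _]; exact: VK.
  by apply: subset_trans hW; apply: closureS; exact: interior_subset.
have /choice[s hs] : forall Vn : set T * nat, exists W,
    good Vn.1 -> good W /\ closure W `<=` Vn.1 `\` F Vn.2.
  move=> [V n] /=; have [gV|nV] := pselect (good V); last by exists set0.
  by have [W hW] := step V n gV; exists W.
pose V := fix V n := if n is k.+1 then s (V k, k) else interior K.
have gV n : good (V n).
  elim: n => [|n IH] /=; last by have [] := hs (V n, n) IH.
  split; [exact: open_interior| |exact: interior_subset].
  by exists x0; exact: x0K.
have VS n : closure (V n.+1) `<=` V n `\` F n by have [] := hs (V n, n) (gV n).
have Vle n k : (n <= k)%N -> V k `<=` V n.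
  elim: k => [|k IH]; first by rewrite leqn0 => /eqP ->.
  rewrite leq_eqVlt => /predU1P[->//|/IH Vkn].
  by apply: subset_trans Vkn => x /(@subset_closure _ (V k.+1)) /VS[].
have /choice[v hv] : forall n, exists x, V n x
  by move=> n; have [_ [x Vx] _] := gV n; exists x.
have [p [Kp clp]] : K `&` cluster (v n @[n --> \oo]) !=set0.
  apply: cK; exists 0%N => // n _ /=; have [_ _] := gV n; apply; exact: hv.
exists p => /MF[n _ Fp].
have : closure (V n.+1) p.
  move=> U Up; apply: (clp (V n.+1) U) => //.
  by exists n.+1 => // k /= nk; apply: (Vle _ _ nk); exact: hv.
by move=> /VS[].
Qed.

(** The sets equal to an open set up to a meager set form a sigma-algebra containing the open
    sets. *)
Lemma borel_baire_property (A : set T) : <<s @open T>> A ->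
  exists2 U, open U & meager (symdiff A U).
Proof.
move: A; apply: smallest_sub => [|U oU]; last first.
  by exists U => //; rewrite /symdiff setDv set0U; exact: meager0.
split.
- exists set0; first exact: open0.
  by rewrite /symdiff setDv set0U; exact: meager0.
- move=> A [U oU mAU]; exists (interior (~` U)); first exact: open_interior.
  rewrite setTD.
  (* Replacing the closed complement of [U] by its interior costs only the boundary, which is closed
     and nowhere dense. *)
  apply: (@meagerS _ (symdiff A U `|` (~` U `\` interior (~` U)))).
    move=> x; have := @interior_subset _ (~` U) x; rewrite /symdiff /=.
    by have := pselect (A x); have := pselect (U x);
      have := pselect (interior (~` U) x); tauto.
  apply: meagerU => //; exists (fun=> ~` U `\` interior (~` U)); last first.
    by move=> x ?; exists 0%N.
  move=> _; split.
    rewrite setDE; apply: closedI; first exact: open_closedC.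
    by apply: open_closedC; exact: open_interior.
  move=> W oW [x Wx] WU; have [_ nint] := WU x Wx; apply: nint.
  by rewrite /interior nbhsE; exists W => // y /WU[? _].
- move=> A hA.
  have /choice[U hU] : forall n, exists U, open U /\ meager (symdiff (A n) U).
    by move=> n; have [U] := hA n; exists U.
  exists (\bigcup_n U n); first by apply: bigcup_open => n _; have [] := hU n.
  apply: (@meagerS _ (\bigcup_n symdiff (A n) (U n))); last first.
    by apply: meager_bigcup => n; have [] := hU n.
  move=> x [[[n _ An] nU]|[[n _ Un] nA]]; exists n => //.
    by left; split=> // Un; apply: nU; exists n.
  by right; split=> // An; apply: nA; exists n.
Qed.

Definition dense_range (g : nat -> T) :=
  forall U, open U -> U !=set0 -> exists i, U (g i).

Lemma second_countable_basis_seq : @second_countable T -> T ->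
  exists B : nat -> set T, (forall n, open (B n)) /\
    forall x U, nbhs x U -> exists2 n, B n x & B n `<=` U.
Proof.
move=> [B cB [oB nB]] x0.
have [V [BV Vx0] _] := nB x0 setT filterT.
have /pfcard_geP[B0|/unsquash s] := cB; first by rewrite B0 in BV.
exists s; split=> [n|x U /nB[W [BW Wx] WU]]; first by apply: oB; exact: funS.
by have [n _ sn] := @surj _ _ _ _ s W BW; exists n; rewrite sn.
Qed.

Lemma second_countable_dense_range : @second_countable T -> T ->
  exists g, dense_range g.
Proof.
move=> scT x0; have [B [oB nB]] := second_countable_basis_seq scT x0.
have /choice[g hg] : forall n, exists x, B n !=set0 -> B n x.
  move=> n; have [[x Bx]|nBn] := pselect (B n !=set0); first by exists x.
  by exists x0.
exists g => U oU [x Ux]; have /nB[n Bx BU] : nbhs x U by exact: open_nbhs_nbhs.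
by exists n; apply/BU/hg; exists x.
Qed.

Lemma dense_range_cvg (g : nat -> T) (a : T) : @second_countable T ->
  dense_range g -> exists i : nat -> nat, g (i n) @[n --> \oo] --> a.
Proof.
move=> scT dg; have [B [oB nB]] := second_countable_basis_seq scT a.
(* The intersection of those among the first [n] basic open sets that contain [a]; picking a term of
   the sequence [g] in each [W n] gives convergence to [a]. *)
pose W n := \bigcap_(k < n) (if `[< B k a >] then B k else setT).
have Wa n : W n a by move=> k _; case: asboolP.
have oW n : open (W n).
  rewrite /W bigcap_mkord; elim/big_ind : _ => //.
  - exact: openT.
  - exact: openI.
  - by move=> k _; case: ifP => // _; exact: openT.
have /choice[i hi] : forall n, exists i, W n (g i).
  by move=> n; apply: dg => //; exists a.
exists i => U /nB[k Bk BU]; exists k.+1 => // n /= kn.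
apply: BU; have := hi n k kn.
by case: asboolP.
Qed.

End category.

(** * Equivariance under a dense sequence *)

Lemma null_set_subset (R : realType) (d : measure_display)
    (X : measurableType d) (m : probability X R) (A B : set X) :
  measurable A -> measurable B -> A `<=` B -> m B = 0%E -> m A = 0%E.
Proof. exact: subset_measure0. Qed.

Section translation.
Context (G : topologicalGroupType).

Lemma continuous_mulg_left (a : G) : continuous (fun b : G => (a * b)%g).
Proof.
move=> b; apply: (@continuous_comp _ _ _ (fun b : G => (a, b))
  (fun p : G * G => (p.1 * p.2)%g)); last exact: mulg_continuous.
apply: cvg_pair; [exact: cvg_cst|exact: cvg_id].
Qed.

Lemma continuous_mulg_right (a : G) : continuous (fun b : G => (b * a)%g).
Proof.
move=> b; apply: (@continuous_comp _ _ _ (fun b : G => (b, a))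
  (fun p : G * G => (p.1 * p.2)%g)); last exact: mulg_continuous.
apply: cvg_pair; [exact: cvg_id|exact: cvg_cst].
Qed.

Lemma meager_translate (a : G) (M : set G) : meager M ->
  meager [set b : G | M (a * b)%g].
Proof.
apply: (@meager_preimage _ (fun b => (a * b)%g) (fun b => (a^-1 * b)%g)).
- exact: continuous_mulg_left.
- exact: continuous_mulg_left.
- by move=> b; rewrite mulgA mulVg mul1g.
- by move=> b; rewrite mulgA mulgV mul1g.
Qed.

End translation.

Section actions.
Context (R : realType) (G : topologicalGroupType) (d : measure_display).
Context (X : measurableType d) (rho : G * X -> X).
Context (hrho : borel_action rho).

Lemma measurable_act (g : G) : measurable_fun [set: X] (fun x => rho (g, x)).
Proof.
apply: (@measurableT_comp _ _ _ _ _ _ (rho : borel G * X -> X) _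
  (fun x => ((g : borel G), x))); first exact: hrho.2.
exact: pair1_measurable.
Qed.

Lemma measurable_act_preimage (g : G) (A : set X) : measurable A ->
  measurable [set x | A (rho (g, x))].
Proof.
by move=> mA; rewrite -[X in measurable X]setTI; exact: measurable_act.
Qed.

Lemma quasi_invariant_null (m : probability X R) (g : G) (N : set X) :
    quasi_invariant rho m -> measurable N ->
  m [set x | N (rho (g, x))] = 0%E <-> m N = 0%E.
Proof.
move=> qm mN; have [h1 h2] := qm g; split=> m0.
- apply: (h2 N) => // B mB BN.
  apply: (null_set_subset _ _ _ m0); last by move=> x /BN.
  + exact: measurable_act_preimage.
  + exact: measurable_act_preimage.
- apply: (h1 N) => // B mB BN.
  exact: (null_set_subset _ _ _ m0).
Qed.

Context (Y : metricType R) (y : nat -> Y) (hy : dense_seq y).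

Lemma borel_fun_act (g : G) (phi : X -> Y) : borel_fun phi ->
  borel_fun (fun x => phi (rho (g, x))).
Proof. by move=> bphi U /bphi; exact: measurable_act_preimage. Qed.

Lemma borel_fun_comp (phi : X -> Y) (h : Y -> Y) : borel_fun phi ->
  continuous h -> borel_fun (fun x => h (phi x)).
Proof.
move=> bphi ch U oU; apply: (bphi (h @^-1` U)).
by apply: open_comp => // z _; exact: ch.
Qed.

(** Joint measurability of the action makes the deviation set measurable in the product; by Tonelli
    the measure of its sections is a Borel function of [g]. This provides the Baire property used
    below. *)
Lemma measurable_deviation (m : probability X R) (phi f : X -> Y) (r : R) :
    borel_fun phi -> borel_fun f ->
  <<s @open G>> [set g | (m [set x | (r <= mdist (phi (rho (g, x))) (f x))%R]
    < r%:E)%E].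
Proof.
move=> bphi bf.
pose S := [set p : borel G * X |
  r <= mdist (phi (rho (p : G * X))) (f p.2)].
have mS : measurable S.
  apply: (@measurable_mdist_ge _ _ _ hy _ _
    (fun p : borel G * X => phi (rho (p : G * X))) (fun p => f p.2)).
    move=> U /bphi mU.
    rewrite -[X in measurable X]setTI; exact: (hrho.2 measurableT _ mU).
  move=> U /bf mU.
  rewrite -[X in measurable X]setTI; exact: (measurable_snd measurableT _ mU).
have := emeasurable_fun_infty_o measurableT (measurable_fun_xsection m mS) r%:E.
rewrite setTI; congr (<<s _ >> _); apply/seteqP.
by split=> g /=; congr (m _ < _)%E; apply/seteqP; split=> x;
  rewrite /xsection /= inE.
Qed.

Context (H : topologicalGroupType) (tau : H * Y -> Y).
Context (htau : continuous_action tau).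
Context (pi : {multiplicative G -> H}).
Context (hpi : continuous pi).

Lemma continuous_act (h : H) : continuous (fun z => tau (h, z)).
Proof.
move=> z; apply: (@continuous_comp _ _ _ (fun z : Y => (h, z)) tau).
  by apply: cvg_pair; [exact: cvg_cst|exact: cvg_id].
exact: htau.2.
Qed.

Lemma continuous_orbit (z : Y) : continuous (fun g => tau (pi g, z)).
Proof.
move=> g; apply: (@continuous_comp _ _ _ (fun g : G => (pi g, z)) tau).
  by apply: cvg_pair; [exact: hpi|exact: cvg_cst].
exact: htau.2.
Qed.

Definition defect (phi : X -> Y) (g : G) :=
  [set x | phi (rho (g, x)) <> tau (pi g, phi x)].

Lemma measurable_defect (phi : X -> Y) (g : G) : borel_fun phi ->
  measurable (defect phi g).
Proof.
move=> bphi; apply: (measurable_neq hy); first exact: borel_fun_act.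
exact: (borel_fun_comp (h := fun z => tau (pi g, z)) bphi (@continuous_act _)).
Qed.

Context (f : nat -> X -> Y) (bf : forall k, borel_fun (f k)).
Context (df : dense_in_measure f).

(* A translate of the sequence [g] and of the point [a] lies in the comeager set
   where the countably many Borel sets [V k j] below agree with open sets; this
   makes [phi (rho (b, x))] continuous in measure along the translated
   sequence, whatever the discontinuities of the orbit map elsewhere. *)
Lemma defect_null_of_dense (m : probability X R) (phi : X -> Y) (g : nat -> G) :
    lcsc_group G -> quasi_invariant rho m -> borel_fun phi -> dense_range g ->
    (forall i, m (defect phi (g i)) = 0%E) ->
  forall a, m (defect phi a) = 0%E.
Proof.
move=> [hausG lcG scG] qm bphi dg g0 a.
pose V k j := [set b : G |
  (m [set x | (hpow j <= mdist (phi (rho (b, x))) (f k x))%R]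
    < (hpow j)%:E)%E].
have /choice[U hU] : forall kj, exists U,
    open U /\ meager (symdiff (V kj.1 kj.2) U).
  move=> [k j]; have [U] := borel_baire_property
    (measurable_deviation m (hpow j) bphi (bf k)).
  by exists U.
pose M := \bigcup_k \bigcup_j symdiff (V k j) (U (k, j)).
have mM : meager M.
  apply: meager_bigcup => k; apply: meager_bigcup => j.
  by have [] := hU (k, j).
have [h hh] : exists h : G, ~ ((\bigcup_i [set b : G | M (g i * b)%g]) `|`
    [set b : G | M (a * b)%g]) h.
  apply: (locally_compact_baire (point : G)) => //.
  apply: meagerU; last exact: meager_translate.
  by apply: meager_bigcup => i; exact: meager_translate.
have gM i : ~ M (g i * h)%g by move=> Mg; apply: hh; left; exists i.
have aM : ~ M (a * h)%g by move=> Ma; apply: hh; right.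
have VU k j b : ~ M b -> V k j b <-> U (k, j) b.
  move=> nM; have : ~ symdiff (V k j) (U (k, j)) b.
    by move=> s; apply: nM; exists k => //; exists j.
  rewrite /symdiff /=.
  by have := pselect (V k j b); have := pselect (U (k, j) b); tauto.
have [i hi] := dense_range_cvg a scG dg.
pose w x := phi (rho (h, x)).
have bw : borel_fun w by exact: borel_fun_act.
have actM b x : rho ((b * h)%g, x) = rho (b, rho (h, x)) by rewrite hrho.1.2.
pose S r :=
  [set x | r <= mdist (phi (rho ((a * h)%g, x))) (tau (pi a, w x))].
have bta b : borel_fun (fun x => tau (pi b, w x)).
  exact: (borel_fun_comp (h := fun z => tau (pi b, z)) bw (@continuous_act _)).
have mS r : measurable (S r).
  by apply: (measurable_mdist_ge hy) => //; exact: borel_fun_act.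
(* Four exceptional sets, each of measure below [hpow j]: two where [f k] is far from the translates
   of [phi] by [a * h] and by [g (i n) * h], the null defect of [g (i n)] pulled back by [h], and
   [D n]. *)
have small j : (m (S (4 * hpow j)%R) < (4 * hpow j)%:E)%E.
  have [k hk] := df m (borel_fun_act (a * h)%g bphi) (hpow_gt0 R j).
  have Ua : U (k, j) (a * h)%g by apply/VU.
  (* Outside [M] the condition [V k j] agrees with an open one, so it spreads from [a * h] to
     [g (i n) * h] for large [n]. *)
  have [N1 hN1] : exists N, forall n, (N <= n)%N -> V k j (g (i n) * h)%g.
    have : nbhs a [set b : G | U (k, j) (b * h)%g].
      apply: (@continuous_mulg_right G h a); apply: open_nbhs_nbhs.
      by split=> //; have [] := hU (k, j).
    by move=> /hi[N _ hN]; exists N => n Nn; apply/VU => //; exact: hN.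
  pose D n :=
    [set x | hpow j <= mdist (tau (pi (g (i n)), w x)) (tau (pi a, w x))].
  have mD n : measurable (D n) by exact: (measurable_mdist_ge hy).
  have [|N2 hN2] := lim_sup_set0_small (m := m) mD _ (hpow_gt0 R j).
    rewrite (_ : lim_sup_set D = set0) ?measure0//; apply/seteqP; split=> // x.
    suff : ~ lim_sup_set D x by [].
    apply/lim_sup_setP.
    have : nbhs (tau (pi a, w x)) (ball (tau (pi a, w x)) (hpow j : R)).
      by apply: nbhsx_ballx; exact: hpow_gt0.
    move=> /(continuous_orbit (z := w x))/hi[N _ hN].
    exists N => n Nn; have := hN n Nn.
    by rewrite /= ballEmdist /= metric_sym /D /= ltNge => /negP.
  pose n := maxn N1 N2.
  have h1 := hN1 n (leq_maxl _ _).
  have h2 := hN2 n (leq_maxr _ _).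
  have h3 : (m [set x | defect phi (g (i n)) (rho (h, x))] < (hpow j)%:E)%E.
    rewrite (_ : m _ = 0%E) ?lte_fin ?hpow_gt0//.
    by apply/(quasi_invariant_null h qm) => //; exact: measurable_defect.
  have mA b : measurable
      [set x | (hpow j <= mdist (phi (rho (b, x))) (f k x))%R].
    by apply: (measurable_mdist_ge hy) => //; exact: borel_fun_act.
  have mB : measurable [set x | defect phi (g (i n)) (rho (h, x))].
    by apply: measurable_act_preimage; exact: measurable_defect.
  have mU12 := measurableU _ _ (mA (a * h)%g) (mA (g (i n) * h)%g).
  have mU34 := measurableU _ _ mB (mD n).
  have l12 := measure_subU_lt (mA _) (mA _) mU12 (@subset_refl _ _) hk h1.
  have l34 := measure_subU_lt mB (mD n) mU34 (@subset_refl _ _) h3 h2.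
  have := measure_subU_lt mU12 mU34 (mS (4 * hpow j)) _ l12 l34.
  rewrite (_ : _ + _ = 4 * hpow j); last by lra.
  apply=> x; rewrite /S /= => hx; apply: contrapT =>
    /not_orP[/not_orP[/= n1 n2] /not_orP[/= n3 n4]].
  move/contrapT : n3; rewrite -actM -/(w x) => e3.
  move: n1 n2 n4 hx => /negP + /negP + /negP +; rewrite -!ltNge e3 => n1 n2 n4.
  have := metric_triangle (phi (rho ((a * h)%g, x))) (f k x)
    (tau (pi (g (i n)), w x)).
  have := metric_triangle (phi (rho ((a * h)%g, x)))
    (tau (pi (g (i n)), w x)) (tau (pi a, w x)).
  rewrite (metric_sym (f k x)); have := hpow_gt0 R j; lra.
(* Quasi-invariance allows the defect of [a] to be tested at [rho (h, x)], where the preceding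
   estimate applies. *)
apply/(quasi_invariant_null h qm); first exact: measurable_defect.
have S0 e : 0 < e -> m (S e) = 0%E.
  move=> e0; apply/eqP; rewrite eq_le measure_ge0 andbT.
  apply/lee_addgt0Pr => r r0; rewrite add0e.
  have [j1 hj1] : exists k : nat, forall j, (k <= j)%N -> hpow j < e / 4.
    by apply: exists_hpow_lt; rewrite divr_gt0.
  have [j2 hj2] : exists k : nat, forall j, (k <= j)%N -> hpow j < r / 4.
    by apply: exists_hpow_lt; rewrite divr_gt0.
  pose j := maxn j1 j2.
  have := hj1 j (leq_maxl _ _); have := hj2 j (leq_maxr _ _) => r4 e4.
  apply: (@le_trans _ _ (m (S (4 * hpow j)))).
    by apply: measure_sub => // x; rewrite /S /=; apply: le_trans; lra.
  by apply: le_trans (ltW (small j)) _; rewrite lee_fin; lra.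
apply: (@null_set_subset _ _ _ _ _ (\bigcup_j S (hpow j))).
- by apply: measurable_act_preimage; exact: measurable_defect.
- exact: bigcupT_measurable.
- move=> x /=; rewrite /defect /= -actM => neq.
  have [k /(_ _ (leqnn k)) hk] : exists k, forall j, (k <= j)%N ->
      hpow j < mdist (phi (rho ((a * h)%g, x))) (tau (pi a, w x)).
    by apply: exists_hpow_lt; rewrite mdist_gt0; exact/eqP.
  by exists k => //; rewrite /S /= ltW.
- apply/negligibleP; first exact: bigcupT_measurable.
  apply: negligible_bigcup => j; apply/negligibleP => //.
  by apply: S0; exact: hpow_gt0.
Qed.

End actions.

(** * Coding of equivariant maps *)

Lemma standard_borel_measurable1 (R : realType) (d : measure_display)
    (T : measurableType d) (w : T) : standard_borel R T ->
  measurable [set w].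
Proof.
move=> [P [f [_ _ /bij_inj injf fB]]].
have -> : [set w] = f @^-1` [set f w].
  by apply/seteqP; split=> [_ ->//|x /injf].
apply/fB; rewrite -[[set f w]]setCK -setTD.
have [_ sC _] := smallest_sigma_algebra setT (@open P).
have cf : closed [set f w].
  by apply: accessible_closed_set1; exact/hausdorff_accessible/metric_hausdorff.
by apply: sC; apply: sub_sigma_algebra; exact: closed_openC.
Qed.

Section tends_to.
Context (R : realType) (Y : metricType R).
Implicit Types (u v : nat -> Y) (z : Y).

Lemma tends_to_hpow u v z : tends_to u z ->
    (exists N, forall n, (N <= n)%N -> mdist (u n) (v n) < hpow n) ->
  tends_to v z.
Proof.
move=> uz [N hN] e e0; have e20 : 0 < e / 2 by rewrite divr_gt0.
have [N1 h1] := uz _ e20; have [N2 h2] := exists_hpow_lt e20.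
exists (maxn N (maxn N1 N2)) => n; rewrite !geq_max => /and3P[Nn N1n N2n].
have := hN _ Nn; have := h1 _ N1n; have := h2 _ N2n.
have := metric_triangle (v n) (u n) z; rewrite (metric_sym (v n) (u n)); lra.
Qed.

Lemma tends_to_cst z : tends_to (fun=> z) z.
Proof. by move=> e e0; exists 0%N => n _; rewrite mdistxx. Qed.

Lemma tends_to_continuous u z (h : Y -> Y) : continuous h -> tends_to u z ->
  tends_to (h \o u) (h z).
Proof.
move=> ch uz e e0.
have /ch /nbhs_ballP[r /= r0 hr] : nbhs (h z) (ball (h z) e).
  exact: nbhsx_ballx.
have [N hN] := uz r r0; exists N => n Nn /=.
have := hr (u n); rewrite !ballEmdist /= metric_sym (metric_sym (h z)); apply.
exact: hN.
Qed.

(** By the geometric series, all terms after the [n]-th stay within [2 * hpow n] of it. Taking [n]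
    with [hpow n] below [hpow k.+2] leaves room for two such tails. *)
Lemma cauchy_at_hpow u :
    (exists N, forall n, (N <= n)%N -> mdist (u n) (u n.+1) < hpow n) ->
  cauchy_at u.
Proof.
move=> [N hN] k.
have tail n j : (N <= n)%N -> mdist (u n) (u (n + j)%N) < 2 * hpow n.
  elim: j n => [|j IH] n Nn.
    by rewrite addn0 mdistxx mulr_gt0// hpow_gt0.
  have := hN n Nn; have := IH n.+1 (leqW Nn); rewrite addSnnS.
  have := metric_triangle (u n) (u n.+1) (u (n + j.+1)%N).
  have := hpowS R n; lra.
have [M hM] := exists_hpow_lt (hpow_gt0 R k.+2).
exists (maxn N M) => m n; rewrite !geq_max => /andP[Nm Mm] /andP[Nn Mn].
have := tail (maxn N M) (m - maxn N M)%N (leq_maxl _ _).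
have := tail (maxn N M) (n - maxn N M)%N (leq_maxl _ _).
rewrite !subnKC ?geq_max ?Nm ?Nn ?Mm ?Mn//.
have := hM (maxn N M) (leq_maxr _ _).
have := metric_triangle (u m) (u (maxn N M)) (u n).
rewrite (metric_sym (u m) (u (maxn N M))).
have := hpowS R k; have := hpowS R k.+1; have := hpow_gt0 R k.+2; lra.
Qed.

End tends_to.

Section approximation.
Context (R : realType) (G H : topologicalGroupType) (d : measure_display).
Context (X : measurableType d) (rho : G * X -> X).
Context (hrho : borel_action rho).
Context (Y : metricType R) (y : nat -> Y) (hy : dense_seq y).
Context (tau : H * Y -> Y).
Context (htau : continuous_action tau).
Context (pi : {multiplicative G -> H}).
Context (f : nat -> X -> Y) (bf : forall k, borel_fun (f k)).
Context (df : dense_in_measure f).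
Context (g : nat -> G).

Definition gap k a b := [set x | hpow k <= mdist (f a x) (f b x)].

Definition equivariance_gap k i a :=
  [set x | hpow k <= mdist (f a (rho (g i, x))) (tau (pi (g i), f a x))].

(** The edge relation of the tree of codes. It sees [m] only through the measures of finitely many
    fixed sets, hence is measurable in [w] for [m = xi w]; at stage [k] only the group elements with
    [i <= k] are tested. *)
Definition approximates (m : probability X R) k a b :=
  (m (gap k a b) < (hpow k)%:E)%E /\
  forall i, (i <= k)%N -> (m (equivariance_gap k i a) < (hpow k)%:E)%E.

Lemma borel_fun_tau (phi : X -> Y) b : borel_fun phi ->
  borel_fun (fun x => tau (pi b, phi x)).
Proof.
move=> bphi; apply: (borel_fun_comp (h := fun z => tau (pi b, z))) => //.
exact: (@continuous_act _ _ _ _ htau).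
Qed.

Lemma measurable_gap k a b : measurable (gap k a b).
Proof. exact: (measurable_mdist_ge hy). Qed.

Lemma measurable_equivariance_gap k i a : measurable (equivariance_gap k i a).
Proof.
apply: (measurable_mdist_ge hy); first exact: (borel_fun_act hrho).
exact: borel_fun_tau.
Qed.

(** Some [f (s n)] converge to [phi] almost everywhere, and by quasi-invariance also at
    [rho (g i, x)]. Continuity of [tau] then makes their equivariance gaps tend to 0 in measure, and
    [b] is taken far enough along [s]. *)
Lemma approximating_seq (m : probability X R) (phi : X -> Y) :
    quasi_invariant rho m -> borel_fun phi ->
    (forall i, m (defect rho tau pi phi (g i)) = 0%E) ->
  exists b : nat -> nat, forall k, approximates m k (b k) (b k.+1).
Proof.
move=> qm bphi phi0.
have /choice[s hs] : forall n, exists a,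
    (m [set x | (hpow n <= mdist (phi x) (f a x))%R] < (hpow n)%:E)%E.
  by move=> n; exact: (df m bphi (hpow_gt0 R n)).
pose D n := [set x | hpow n <= mdist (phi x) (f (s n) x)].
have mD n : measurable (D n) by exact: (measurable_mdist_ge hy).
have D0 : m (lim_sup_set D) = 0%E by exact: measure_lim_sup_set0.
have mlD := measurable_lim_sup mD.
have small k i : exists N, forall n, (N <= n)%N ->
    (m (equivariance_gap k i (s n)) < (hpow k)%:E)%E.
  apply: lim_sup_set0_small; last exact: hpow_gt0.
    by move=> n; exact: measurable_equivariance_gap.
  have mlE : measurable (lim_sup_set (fun n => equivariance_gap k i (s n))).
    by apply: measurable_lim_sup => n; exact: measurable_equivariance_gap.
  have mdef : measurable (defect rho tau pi phi (g i)).
    exact: (measurable_defect hrho hy htau).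
  have mpre : measurable [set x | lim_sup_set D (rho (g i, x))].
    exact: (measurable_act_preimage hrho).
  apply: (null_set_subset (B := lim_sup_set D `|`
    ([set x | lim_sup_set D (rho (g i, x))] `|` defect rho tau pi phi (g i)))).
  - exact: mlE.
  - by apply: measurableU => //; exact: measurableU.
  - move=> x; apply: contraPP => /not_orP[n1 /not_orP[n2 n3]].
    have cv z : ~ lim_sup_set D z -> tends_to (fun n => f (s n) z) (phi z).
      move=> /lim_sup_setP[N hN]; apply: tends_to_hpow (tends_to_cst (phi z)) _.
      by exists N => n /hN; rewrite /D /= ltNge => /negP.
    apply/lim_sup_setP.
    have := cv _ n2; move/contrapT : n3 => -> c2.
    have c1 := tends_to_continuous (continuous_act htau (h := pi (g i)))
      (cv _ n1).
    have e0 : 0 < hpow k.+1 :> R by exact: hpow_gt0.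
    have [N1 h1] := c1 _ e0; have [N2 h2] := c2 _ e0.
    exists (maxn N1 N2) => n; rewrite geq_max => /andP[N1n N2n].
    have := h1 _ N1n; have := h2 _ N2n; rewrite /equivariance_gap /= => d2 d1.
    apply/negP; rewrite -ltNge.
    have := metric_triangle (f (s n) (rho (g i, x))) (tau (pi (g i), phi x))
      (tau (pi (g i), f (s n) x)).
    rewrite (metric_sym (tau (pi (g i), phi x))) (hpowS R k); lra.
  - apply/negligibleP; first by apply: measurableU => //; exact: measurableU.
    apply: negligibleU; first exact/negligibleP.
    apply: negligibleU; last by apply/negligibleP => //; exact: phi0.
    by apply/negligibleP => //; apply/(quasi_invariant_null hrho).
(* The bound [hpow k.+1] on the deviation from [phi] makes consecutive choices differ by less than
   [hpow k.+1 + hpow k.+2], which is below [hpow k]. *)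
have /choice[b hb] : forall k, exists a,
    (m [set x | (hpow k.+1 <= mdist (phi x) (f a x))%R] < (hpow k.+1)%:E)%E /\
    forall i, (i <= k)%N -> (m (equivariance_gap k i a) < (hpow k)%:E)%E.
  move=> k; have /choice[N hN] := small k.
  pose M := maxn k.+1 (\max_(i < k.+1) N i).
  have kM : (k.+1 <= M)%N by exact: leq_maxl.
  have hle : hpow M <= hpow k.+1 :> R.
    exact: hpow_le.
  exists (s M); split.
    apply: (@le_lt_trans _ _ (m (D M))); last first.
      by apply: lt_le_trans (hs M) _; rewrite lee_fin.
    apply: measure_sub => //; first exact: (measurable_mdist_ge hy).
    by move=> x /=; exact: (le_trans hle).
  move=> i ik; apply: hN; apply: leq_trans (leq_maxr _ _).
  by rewrite -ltnS in ik; exact: (leq_bigmax (Ordinal ik)).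
exists b => k; split; last by have [] := hb k.
have [h1 _] := hb k; have [h2 _] := hb k.+1.
have := measure_subU_lt _ _ (measurable_gap k (b k) (b k.+1)) _ h1 h2.
move=> h; apply: (@lt_le_trans _ _ (hpow k.+1 + hpow k.+2)%:E); last first.
  rewrite lee_fin (hpowS R k) (hpowS R k.+1); have := hpow_gt0 R k.+2; lra.
apply: h; try exact: (measurable_mdist_ge hy).
move=> x; rewrite /gap /= => hx; apply: contrapT => /not_orP[/= /negP + /negP].
rewrite -!ltNge => l1 l2; move: hx.
have := metric_triangle (f (b k) x) (phi x) (f (b k.+1) x).
rewrite (metric_sym (f (b k) x) (phi x)) (hpowS R k) (hpowS R k.+1).
have := hpow_gt0 R k.+2; move: l1; rewrite (hpowS R k.+1); lra.
Qed.

(** By Borel-Cantelli, almost every [x] has the [f (b n)] Cauchy at [x] and at [rho (g i, x)], with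
    equivariance gaps tending to 0, so the two limits correspond. The maps [u n] are needed because
    the index sequence varies with the fibre; [D] is one fibre. *)
Lemma limit_defect_null (m : probability X R) (b : nat -> nat) (D : set X)
    (u : nat -> X -> Y) (phi : X -> Y) (i : nat) : quasi_invariant rho m ->
    (forall k, approximates m k (b k) (b k.+1)) ->
    measurable D -> m (~` D) = 0%E -> (forall a x, D x -> D (rho (a, x))) ->
    (forall n x, D x -> u n x = f (b n) x) -> borel_fun phi ->
    (forall x, cauchy_at (u ^~ x) -> tends_to (u ^~ x) (phi x)) ->
  m (defect rho tau pi phi (g i)) = 0%E.
Proof.
move=> qm hb mD D0 invD uf bphi phiu.
pose A n := gap n (b n) (b n.+1).
have mA n : measurable (A n) by exact: measurable_gap.
have A0 : m (lim_sup_set A) = 0%E.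
  by apply: measure_lim_sup_set0 => // n; have [] := hb n.
(* The shift by [i] is needed because [approximates] controls [g i] only from stage [i] on. *)
pose B n := equivariance_gap (n + i) i (b (n + i)%N).
have mB n : measurable (B n) by exact: measurable_equivariance_gap.
have B0 : m (lim_sup_set B) = 0%E.
  apply: measure_lim_sup_set0 => // n; have [_ h] := hb (n + i)%N.
  apply: lt_le_trans (h i (leq_addl _ _)) _; rewrite lee_fin.
  by apply: hpow_le; exact: leq_addr.
have mlA := measurable_lim_sup mA; have mlB := measurable_lim_sup mB.
have mpre : measurable [set x | lim_sup_set A (rho (g i, x))].
  exact: (measurable_act_preimage hrho).
have mDC : measurable (~` D) by exact: measurableC.
apply: (null_set_subset (B := (~` D `|` lim_sup_set A) `|`
  ([set x | lim_sup_set A (rho (g i, x))] `|` lim_sup_set B))).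
- exact: (measurable_defect hrho hy htau).
- by apply: measurableU; exact: measurableU.
- move=> x; apply: contraPP => /not_orP[/not_orP[/contrapT Dx nA]
    /not_orP[nA' /lim_sup_setP[N hN]]] hdef.
  have cv z : D z -> ~ lim_sup_set A z -> tends_to (fun n => f (b n) z) (phi z).
    move=> Dz /lim_sup_setP[M hM].
    rewrite (_ : (fun n => f (b n) z) = u ^~ z); last first.
      by apply/funext => n; rewrite uf.
    apply: phiu; apply: cauchy_at_hpow; exists M => n /hM.
    by rewrite /A /gap /= !uf// ltNge => /negP.
  apply: hdef.
  have c1 := tends_to_continuous (continuous_act htau (h := pi (g i)))
    (cv _ Dx nA).
  apply: tends_to_unique c1.
  apply: tends_to_hpow (cv _ (invD _ _ Dx) nA') _.
  exists (N + i)%N => n Nn; have iN : (i <= n)%N.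
    by apply: leq_trans Nn; exact: leq_addl.
  have := hN (n - i)%N; rewrite leq_subRL// addnC => /(_ Nn).
  by rewrite /B subnK// /equivariance_gap /= ltNge => /negP.
- apply/negligibleP; first by apply: measurableU; exact: measurableU.
  apply: negligibleU; apply: negligibleU; apply/negligibleP => //.
  by apply/(quasi_invariant_null hrho).
Qed.

End approximation.

(** * Ergodic decompositions *)

Lemma ae_exists (R : realType) (d : measure_display) (X : measurableType d)
    (m : probability X R) (P : X -> Prop) : {ae m, forall x, P x} ->
  exists x, P x.
Proof.
move=> [N [mN N0 hN]]; apply: contrapT => nP.
have : m setT = 0%E.
  apply: (null_set_subset measurableT mN) N0 => x _; apply: hN => Px.
  by apply: nP; exists x.
by rewrite probability_setT => /eqP; rewrite onee_eq0.
Qed.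

Section decomposition.
Context (R : realType) (G : topologicalGroupType) (d d' : measure_display).
Context (X : measurableType d) (Omega : measurableType d').
Context (rho : G * X -> X) (mu : probability X R) (nu : probability Omega R).
Context (X' : set X) (psi : X -> Omega) (xi : Omega -> pprobability X R).
Context (hdec : ergodic_decomposition rho mu nu X' psi xi).

Lemma measurable_decomp (A : set X) : measurable A ->
  measurable_fun [set: Omega] (fun w => xi w A).
Proof. exact: (measurable_kernel (kprobability (decomp_xi hdec))). Qed.

(** A nonnegative function has integral 0 exactly when it vanishes almost everywhere. The
    exceptional set of [w] depends on [A], which is why only countably many defects are
    transferred. *)
Lemma decomp_null (A : set X) : measurable A ->
  mu A = 0%E <-> {ae nu, forall w, xi w A = 0%E}.
Proof.
move=> mA; rewrite (decomp_integral hdec mA).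
have -> : (\int[nu]_w xi w A = \int[nu]_w `|xi w A|)%E.
  by apply: eq_integral => w _; rewrite gee0_abs.
rewrite (ae_eq_integral_abs nu measurableT (measurable_decomp mA)).
by split; apply: filterS => w /=; [exact|move=> ? _].
Qed.

Lemma measurable_fiber w : measurable (fiber X' psi w).
Proof.
apply: (decomp_psi hdec (decomp_measurable hdec)).
exact: (standard_borel_measurable1 _ (decomp_standard hdec)).
Qed.

Lemma fiber_null w : xi w (~` fiber X' psi w) = 0%E.
Proof.
rewrite probability_setC; last exact: measurable_fiber.
by rewrite (decomp_fiber hdec) subee.
Qed.

Lemma fiber_act w a x : fiber X' psi w x -> fiber X' psi w (rho (a, x)).
Proof.
move=> [X'x px]; split; last by rewrite /= (decomp_psi_invariant hdec).
by have := decomp_invariant hdec a => /seteqP[_]; exact.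
Qed.

End decomposition.

Theorem corollary5p4 (R : realType)
  (G H : topologicalGroupType) (hG : lcsc_group G) (hH : lcsc_group H)
  (d : measure_display) (X : measurableType d) (hX : standard_borel R X)
  (mu : probability X R)
  (rho : G * X -> X) (hrho : borel_action rho) (hmu : quasi_invariant rho mu)
  (d' : measure_display) (Omega : measurableType d') (nu : probability Omega R)
  (X' : set X) (psi : X -> Omega) (xi : Omega -> pprobability X R)
  (hdec : ergodic_decomposition rho mu nu X' psi xi)
  (Y : metricType R) (hYc : complete_space Y) (hYs : separable_space Y)
  (tau : H * Y -> Y) (htau : continuous_action tau)
  (pi : {multiplicative G -> H}) (hpi : continuous pi) :
  (exists phi : X -> Y,
     borel_map [set: X] phi /\
     essentially_equivariant rho tau pi [set: X] mu phi)
  <->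
  {ae nu, forall w : Omega, exists phi_w : X -> Y,
     borel_map (fiber X' psi w) phi_w /\
     essentially_equivariant rho tau pi (fiber X' psi w) (xi w) phi_w}.
Proof.
have [_ _ scG] := hG.
have [g dg] := second_countable_dense_range scG point.
have [B [mB gB]] := standard_borel_countably_generated hX.
split=> [[phi [bphi ephi]]|hae].
  have [y hy] := separable_dense_seq hYs (phi point).
  have [f [bf df]] := dense_borel_seq mB gB hy.
  move/borel_map_setT : bphi => bphi.
  have mdef a := measurable_defect hrho hy htau pi a bphi.
  have : {ae nu, forall w, forall i, xi w (defect rho tau pi phi (g i)) = 0%E}.
    apply: ae_foralln => i; apply/(decomp_null hdec) => //.
    apply/negligibleP => //; apply: negligibleS (ephi (g i)).
    by move=> x /= ne eq; apply: ne; exact: eq.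
  apply: filterS => w w0; exists phi; split.
    apply/borel_mapP; first exact: (measurable_fiber hdec).
    move=> U oU; apply: measurableI; last exact: bphi.
    exact: (measurable_fiber hdec).
  move=> a; exists (defect rho tau pi phi a); split=> //.
    exact: (defect_null_of_dense hrho hy htau hpi bf df hG
      (decomp_quasi_invariant hdec w) bphi dg w0).
  by move=> x /= ne eq; apply: ne.
(* [Y] is not known to be nonempty; one fibre map already provides a point of it, hence a dense
   sequence. *)
have [w0 [phi0 _]] := ae_exists hae.
have [y hy] := separable_dense_seq hYs (phi0 point).
have [f [bf df]] := dense_borel_seq mB gB hy.
pose Q k a b := [set w | approximates rho tau pi f g (xi w) k a b].
have mQ k a b : measurable (Q k a b).
  have mlt (A : set X) (r : \bar R) : measurable A ->
      measurable [set w | (xi w A < r)%E].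
    move=> mA; rewrite -[X in measurable X]setTI.
    exact: (emeasurable_fun_infty_o measurableT (measurable_decomp hdec mA)).
  rewrite (_ : Q k a b = [set w | (xi w (gap f k a b) < (hpow k)%:E)%E] `&`
      \bigcap_i (if (i <= k)%N then [set w |
        (xi w (equivariance_gap rho tau pi f g k i a) < (hpow k)%:E)%E]
        else setT)).
    apply: measurableI; first by apply: mlt; exact: (measurable_gap hy).
    apply: bigcapT_measurable => i; case: ifP => // _.
    by apply: mlt; exact: (measurable_equivariance_gap hrho hy htau).
  apply/seteqP; split=> w [hw h]; split=> // i; first by case: ifP => // /h.
  by move=> ik; have := h i I; rewrite ik.
have [|c [mc hc]] := measurable_branch (m := nu) mQ.
  apply: filterS hae => w [phi_w [bphi_w ephi_w]].
  pose D := fiber X' psi w.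
  have mD : measurable D := measurable_fiber hdec w.
  (* The fibre map is Borel only on [D]. Extending it by a constant makes it Borel on [X] and
     changes no defect on the conull invariant set [D]. *)
  pose phi x := if `[< D x >] then phi_w x else y 0%N.
  have phiD x : D x -> phi x = phi_w x.
    by move=> Dx; rewrite /phi; case: asboolP.
  have bphi : borel_fun phi.
    move=> U oU; rewrite (_ : _ @^-1` _ = (D `&` phi_w @^-1` U) `|`
        (~` D `&` (fun=> y 0%N) @^-1` U)).
      apply: measurableU; first by move/borel_mapP : bphi_w => /(_ mD); exact.
      by apply: measurableI; [exact: measurableC|exact: borel_fun_cst].
    by apply/seteqP; split=> x; rewrite /phi /=; case: asboolP => Dx; tauto.
  apply: (approximating_seq hrho hy htau bf df
    (decomp_quasi_invariant hdec w) bphi).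
  move=> i; have [N [mN N0 hN]] := ephi_w (g i).
  apply: (null_set_subset (B := ~` D `|` N)).
  - exact: (measurable_defect hrho hy htau).
  - by apply: measurableU => //; exact: measurableC.
  - move=> x; rewrite /defect /= => hx.
    have [Dx|nDx] := pselect (D x); [right|by left].
    apply: hN => /= h; apply: hx; rewrite !phiD//; first exact: h.
    exact: (fiber_act hdec).
  - apply/negligibleP; first by apply: measurableU => //; exact: measurableC.
    apply: negligibleU; apply/negligibleP => //; first exact: measurableC.
    exact: (fiber_null hdec).
(* On each fibre the selected indices are constant, so [u n] is there a single [f]. Off [X'] the
   values of [psi] mean nothing, and a constant is used. *)
pose u n x := if `[< X' x >] then f (c n (psi x)) x else y 0%N.
have mX' := decomp_measurable hdec.
have bu n : borel_fun (u n).
  move=> U oU; rewrite (_ : _ @^-1` _ = (\bigcup_a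
     ((X' `&` psi @^-1` (c n @^-1` [set a])) `&` f a @^-1` U)) `|`
     (~` X' `&` (fun=> y 0%N) @^-1` U)).
    apply: measurableU.
      apply: bigcupT_measurable => a; apply: measurableI; last exact: bf.
      exact: (decomp_psi hdec).
    by apply: measurableI; [exact: measurableC|exact: borel_fun_cst].
  apply/seteqP; split=> x; rewrite /u /=; case: asboolP => X'x.
  - by move=> Ux; left; exists (c n (psi x)).
  - by move=> Ux; right.
  - by move=> [[a _ [[_ /= ->]]]//|[]//].
  - by move=> [[a _ [[]]]//|[]//].
have [phi bphi hphi] := borel_limit hy hYc bu.
have mdef a := measurable_defect hrho hy htau pi a bphi.
exists phi; split; first exact/borel_map_setT.
move=> a; exists (defect rho tau pi phi a); split=> //; last first.
  by move=> x /= ne eq; apply: ne.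
apply: (defect_null_of_dense hrho hy htau hpi bf df hG hmu bphi dg) => i.
(* Nullity for [mu] is checked fibrewise, at those [w] where the selection follows a branch of the
   tree. *)
apply/(decomp_null hdec) => //; apply: filterS hc => w hw.
apply: (limit_defect_null hrho hy htau bf (b := c ^~ w) (u := u)
  i (decomp_quasi_invariant hdec w) hw (measurable_fiber hdec w)
  (fiber_null hdec w)) => //.
- by move=> b x; exact: (fiber_act hdec).
- by move=> n x [X'x /= <-]; rewrite /u; case: asboolP.
Qed.
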